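(* Let $\Bbbk$ be a field of characteristic zero and let $\mathfrak g_\circ=\bigoplus_{j=1}^6L_j$ be the $14$-dimensional graded Lie algebra defined in the context, with $H^q_w=H^q_w(\mathfrak g_\circ;\mathfrak g_\circ)$ the weight-$w$ adjoint cohomology. The following four maps induced by the Nijenhuis–Richardson bracket are surjective, with the indicated ranks: $$\begin{array}{rcll}\operatorname{Sym}^2H^2_{-2}&\longrightarrow&H^3_{-4},&\operatorname{rank}=39,\\H^2_{-2}\otimes H^2_{-1}&\longrightarrow&H^3_{-3},&\operatorname{rank}=12,\\H^2_{-2}\otimes H^2_0&\longrightarrow&H^3_{-2},&\operatorname{rank}=2,\\\operatorname{Sym}^2H^2_{-1}&\longrightarrow&H^3_{-2},&\operatorname{rank}=2.\end{array}$$ In particular, the negative-weight deformation problem is not unobstructed (there are negative-weight classes $[\phi]$ with nonzero primary obstruction $[\tfrac12[\phi,\phi]_{\mathrm{NR}}]$).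
   Context: $\mathfrak g_\circ$ has homogeneous basis $X,Y\in L_1$; $Z_0\in L_2$; $Z_x,Z_y\in L_3$; $Z_{x^2},Z_{xy},Z_{y^2}\in L_4$; $Z_{x^3},Z_{x^2y},Z_{xy^2},Z_{y^3}\in L_5$; $T_0,T_1\in L_6$. The bracket $\mu$ is $[X,Y]=Z_0$, $[X,Z_p]=Z_{xp}$, $[Y,Z_p]=Z_{yp}$ for monomials $p$ in $x,y$ of degree $\le3$ (with $Z_1=Z_0$), where $Z_{x^4}=Z_{y^4}=T_0$, $Z_{x^3y}=Z_{xy^3}=T_1$, $Z_{x^2y^2}=0$; $L_6$ is central and $\bigoplus_{j\ge2}L_j$ is abelian. $C^q=\operatorname{Hom}(\Lambda^q\mathfrak g_\circ,\mathfrak g_\circ)$ is the adjoint Chevalley–Eilenberg complex; $C^q_w$ consists of cochains with $f(L_{i_1},\dots,L_{i_q})\subseteq L_{i_1+\cdots+i_q+w}$; $H^q_w$ is its weight-$w$ cohomology. The Nijenhuis–Richardson bracket of 2-cochains is the 3-cochain $[\phi,\psi]_{\mathrm{NR}}=\phi\circ\psi+\psi\circ\phi$, with $(\phi\circ\psi)(a,b,c)=\phi(\psi(a,b),c)+\phi(\psi(b,c),a)+\phi(\psi(c,a),b)$; with this convention $[\mu,f]_{\mathrm{NR}}=-df$ for $f\in C^2$. It induces graded-symmetric pairings $H^2_a\otimes H^2_b\to H^3_{a+b}$. The primary obstruction of $[\phi]\in H^2$ is $[\frac12[\phi,\phi]_{\mathrm{NR}}]\in H^3$. *)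

(* Defs.v *)
From HB Require Import structures.
From mathcomp Require Import all_boot all_order all_algebra.
From mathcomp Require Import boolp classical_sets.

Set Implicit Arguments.
Unset Strict Implicit.
Unset Printing Implicit Defensive.

Import GRing.Theory.
Local Open Scope ring_scope.

(** * Linear algebra: subspaces from predicates, subquotients, tensor products *)

Section LinearAlgebra.
Variable K : fieldType.

(* The subspace of all vectors satisfying [P]; only meaningful when these
   vectors form a subspace, see [mem_vspace_of]. *)
Definition vspace_of (V : vectType K) (P : V -> Prop) : {vspace V} :=
  xget 0%VS [set U : {vspace V} | forall v, v \in U <-> P v]%classic.

Lemma mem_vspace_of (V : vectType K) (P : V -> Prop) :
  P 0 -> (forall a u v, P u -> P v -> P (a *: u + v)) ->
  forall v, v \in vspace_of P <-> P v.
Proof.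
move=> P0 PD; suff [U hU] : exists U : {vspace V}, forall v, v \in U <-> P v.
  by move=> v; rewrite /vspace_of; case: xgetP => [W _ /= ->|/(_ U)].
pose S n := `[< exists U : {vspace V}, \dim U = n /\ forall v, v \in U -> P v >].
have exS : exists n, S n.
  exists 0%N; apply/asboolP; exists 0%VS; split; first exact: dimv0.
  by move=> v; rewrite memv0 => /eqP ->.
have leS n : S n -> (n <= \dim {:V})%N.
  by move=> /asboolP [U [<- _]]; apply/dimvS/subvf.
case: (ex_maxnP exS leS) => n /asboolP [U [dU PU]] maxU.
exists U => v; split=> [/PU //|Pv].
have PUv u : u \in (U + <[v]>)%VS -> P u.
  move=> /memv_addP [x xU [y /vlineP [a ->] ->]].
  by rewrite addrC; apply: PD => //; apply: PU.
have le_dim : (\dim (U + <[v]>) <= \dim U)%N.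
  by rewrite dU; apply: maxU; apply/asboolP; exists (U + <[v]>)%VS.
have /eqP -> : U == (U + <[v]>)%VS by rewrite eqEdim addvSl.
by rewrite (subvP (addvSr _ _)) ?memv_line.
Qed.

Lemma linfunE (V W : vectType K) (f : V -> W) : linear f -> linfun f =1 f.
Proof.
move=> lf v.
pose fL : {linear V -> W} :=
  HB.pack f (GRing.isLinear.Build K V W *:%R f lf).
exact: (lfunE fL).
Qed.

(* The quotient Z / (Z :&: B), realised on the complement [Z :\: B] of B in Z;
   [vclass Z B] maps a vector of Z to its class, and [vsval] picks
   representatives. *)
Definition vquot (V : vectType K) (Z B : {vspace V}) : vectType K :=
  subvs_of (Z :\: B)%VS.

Definition vclass (V : vectType K) (Z B : {vspace V}) : 'Hom(V, vquot Z B) :=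
  linfun (vsproj (Z :\: B)%VS \o addv_pi1 Z B).

Lemma vclass_vsval (V : vectType K) (Z B : {vspace V}) (h : vquot Z B) :
  vclass Z B (vsval h) = h.
Proof.
by rewrite lfunE /= daddv_pi_id ?capv_diff ?subvsP // vsvalK.
Qed.

Lemma vsval_vclass (V : vectType K) (Z B : {vspace V}) (z : V) :
  (B <= Z)%VS -> z \in Z -> z - vsval (vclass Z B z) \in B.
Proof.
move=> sBZ zZ; rewrite lfunE /= vsprojK ?memv_pi //.
have zDB : z \in (Z :\: B + B)%VS by rewrite addv_diff (addv_idPl sBZ).
by rewrite -{1}(daddv_pi_add (capv_diff Z B) zDB) addrAC subrr add0r memv_pi.
Qed.

Lemma vclass_eq0 (V : vectType K) (Z B : {vspace V}) (z : V) :
  (B <= Z)%VS -> z \in Z -> (vclass Z B z == 0) = (z \in B).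
Proof.
move=> sBZ zZ; have h := vsval_vclass sBZ zZ.
apply/eqP/idP => [z0|zB]; first by move: h; rewrite z0 (linear0 vsval) subr0.
have: vsval (vclass Z B z) \in ((Z :\: B) :&: B)%VS.
  rewrite memv_cap subvsP /=; move: (rpredB zB h).
  by rewrite opprB addrC subrK.
by rewrite capv_diff memv0 => /eqP h0; apply: val_inj; rewrite /= h0.
Qed.

Lemma vclass_eq (V : vectType K) (Z B : {vspace V}) (y z : V) :
  (B <= Z)%VS -> y \in Z -> z \in Z ->
  (vclass Z B y == vclass Z B z) = (y - z \in B).
Proof.
by move=> sBZ yZ zZ; rewrite -subr_eq0 -linearB vclass_eq0 // rpredB.
Qed.

(* U (x) W in coordinates: the matrix unit (i, j) is the tensor product of the
   i-th and j-th vectors of fixed bases of U and W. *)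
Definition tensor (U W : vectType K) : vectType K :=
  'M[K]_(\dim {:U}, \dim {:W}).

Definition tens (U W : vectType K) (u : U) (w : W) : tensor U W :=
  \matrix_(i, j) (coord (vbasis {:U}) i u * coord (vbasis {:W}) j w).

Definition tensor_lift (U W X : vectType K) (b : U -> W -> X) :
    'Hom(tensor U W, X) :=
  linfun (fun M : 'M[K]_(\dim {:U}, \dim {:W}) =>
    \sum_i \sum_j M i j *: b (vbasis {:U})`_i (vbasis {:W})`_j).

Lemma tensor_lift_sum (U W X : vectType K) (b : U -> W -> X)
    (M : 'M[K]_(\dim {:U}, \dim {:W})) :
  tensor_lift b M =
    \sum_i \sum_j M i j *: b (vbasis {:U})`_i (vbasis {:W})`_j.
Proof.
rewrite linfunE // => a A B.
rewrite scaler_sumr -big_split; apply: eq_bigr => i _ /=.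
rewrite scaler_sumr -big_split; apply: eq_bigr => j _ /=.
by rewrite !mxE scalerDl scalerA.
Qed.

Lemma tensor_liftE (U W X : vectType K) (b : U -> W -> X) u w :
    (forall w, linear (b^~ w)) -> (forall u, linear (b u)) ->
  tensor_lift b (tens u w) = b u w.
Proof.
move=> bl br.
have bsl (I : Type) r (F : I -> U) w' : b (\sum_(i <- r) F i) w' =
    \sum_(i <- r) b (F i) w'.
  pose bL : {linear U -> X} :=
    HB.pack (b^~ w') (GRing.isLinear.Build K U X *:%R (b^~ w') (bl w')).
  exact: (raddf_sum bL).
have bsr (I : Type) r (F : I -> W) u' : b u' (\sum_(i <- r) F i) =
    \sum_(i <- r) b u' (F i).
  pose bR : {linear W -> X} :=
    HB.pack (b u') (GRing.isLinear.Build K W X *:%R (b u') (br u')).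
  exact: (raddf_sum bR).
have b0l w' : b 0 w' = 0 by have:= bsl void [::] (fun=> 0) w'; rewrite !big_nil.
have b0r u' : b u' 0 = 0 by have:= bsr void [::] (fun=> 0) u'; rewrite !big_nil.
rewrite tensor_lift_sum.
rewrite [in RHS](coord_vbasis (memvf u)) [in RHS](coord_vbasis (memvf w)) bsl.
apply: eq_bigr => i _; rewrite bsr; apply: eq_bigr => j _.
have := br (coord (vbasis {:U}) i u *: (vbasis {:U})`_i).
move=> /(_ (coord (vbasis {:W}) j w) (vbasis {:W})`_j 0).
rewrite addr0 b0r addr0 => ->.
have := bl (vbasis {:W})`_j (coord (vbasis {:U}) i u) (vbasis {:U})`_i 0.
by rewrite addr0 b0l addr0 => ->; rewrite mxE scalerA mulrC.
Qed.

Lemma skew_linear n : linear (fun M : 'M[K]_n => M - M^T).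
Proof.
by move=> a A B; apply/matrixP=> i j; rewrite !mxE mulrBr opprD addrACA.
Qed.

(* Sym^2 U is the quotient of U (x) U by the span of the u (x) v - v (x) u;
   transposition exchanges u (x) v and v (x) u. *)
Definition sym2_rel (U : vectType K) : {vspace tensor U U} :=
  limg (linfun (fun M : 'M[K]_(\dim {:U}) => M - M^T) : 'End(tensor U U)).

Definition sym2 (U : vectType K) : vectType K := vquot fullv (sym2_rel U).

Definition smul (U : vectType K) (u v : U) : sym2 U :=
  vclass fullv (sym2_rel U) (tens u v).

Definition sym2_lift (U X : vectType K) (b : U -> U -> X) : 'Hom(sym2 U, X) :=
  (tensor_lift b \o linfun vsval)%VF.

Lemma sym2_liftE (U X : vectType K) (b : U -> U -> X) u v :
    (forall w, linear (b^~ w)) -> (forall u, linear (b u)) ->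
    (forall u v, b u v = b v u) ->
  sym2_lift b (smul u v) = b u v.
Proof.
move=> bl br bC; rewrite -(tensor_liftE u v bl br) comp_lfunE lfunE /=.
apply/eqP; rewrite eq_sym -subr_eq0 -linearB /=.
have := @vsval_vclass _ fullv (sym2_rel U) (tens u v) (subvf _) (memvf _).
move=> /memv_imgP [M _ ->]; rewrite (linfunE (@skew_linear _)).
rewrite linearB /= subr_eq0; apply/eqP.
rewrite !tensor_lift_sum exchange_big; apply: eq_bigr => i _; apply: eq_bigr => j _.
by rewrite mxE bC.
Qed.

End LinearAlgebra.

(** * The graded Lie algebra *)

(* Basis indices: 0 = X, 1 = Y, 2 + i = Z_p for the i-th monomial p of
   [monomials], 12 = T_0, 13 = T_1. A monomial x^a y^b is the pair (a, b). *)
Definition monomials : seq (nat * nat) :=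
  [:: (0, 0); (1, 0); (0, 1); (2, 0); (1, 1); (0, 2);
      (3, 0); (2, 1); (1, 2); (0, 3)]%N.

Definition bdeg (i : 'I_14) : nat :=
  nth 0%N [:: 1; 1; 2; 3; 3; 4; 4; 4; 5; 5; 5; 5; 6; 6]%N i.

Section LieAlgebra.
Variable K : fieldType.

Local Notation g := 'rV[K]_14.

Definition bvec (n : nat) : g := \row_(j < 14) (val j == n)%:R.

(* Z_{x^a y^b}, with Z_{x^4} = Z_{y^4} = T_0, Z_{x^3 y} = Z_{x y^3} = T_1 and
   Z_{x^2 y^2} = 0. *)
Definition Zvec (p : nat * nat) : g :=
  if p \in monomials then bvec (2 + index p monomials)
  else if p \in [:: (4, 0); (0, 4)]%N then bvec 12
  else if p \in [:: (3, 1); (1, 3)]%N then bvec 13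
  else 0.

(* [X, e_j] and [Y, e_j]. *)
Definition adX (j : nat) : g :=
  if j == 1%N then Zvec (0, 0)%N
  else if (2 <= j < 12)%N then
    let: (a, b) := nth (0, 0)%N monomials (j - 2) in Zvec (a.+1, b)
  else 0.

Definition adY (j : nat) : g :=
  if j == 0%N then - Zvec (0, 0)%N
  else if (2 <= j < 12)%N then
    let: (a, b) := nth (0, 0)%N monomials (j - 2) in Zvec (a, b.+1)
  else 0.

Definition basis_bracket (i j : nat) : g :=
  match i, j with
  | 0, _ => adX j
  | 1, _ => adY j
  | _, 0 => - adX i
  | _, 1 => - adY i
  | _, _ => 0%R
  end%N.

Definition bracket (u v : g) : g :=
  \sum_(i < 14) \sum_(j < 14) (u 0 i * v 0 j) *: basis_bracket i j.

(* The homogeneous component L_n, which is 0 unless 1 <= n <= 6. *)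
Definition gcomp (n : int) : {vspace g} :=
  (\sum_(i < 14 | (bdeg i)%:Z == n) <[bvec i]>)%VS.

(** * The adjoint Chevalley-Eilenberg complex *)

(* A q-linear map g^q -> g is stored as the family of its values on q-tuples of
   basis vectors; [app f x] evaluates it on a list x of q vectors, and [mk F]
   stores the q-linear map F. *)
Definition multilinear (q : nat) : vectType K := {ffun q.-tuple 'I_14 -> g}.

Definition app (q : nat) (f : multilinear q) (x : seq g) : g :=
  \sum_(t : q.-tuple 'I_14)
    (\prod_(i < q) (x`_i : g) 0 (tnth t i)) *: (f : {ffun _ -> g}) t.

Definition mk (q : nat) (F : seq g -> g) : multilinear q :=
  [ffun t : q.-tuple 'I_14 => F [seq bvec (val i) | i <- t]].

Definition alternating (q : nat) (f : multilinear q) : Prop :=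
  forall x : q.-tuple g, ~~ uniq x -> app f x = 0.

Definition has_weight (q : nat) (w : int) (f : multilinear q) : Prop :=
  forall (n : q.-tuple int) (x : q.-tuple g),
    (forall i, tnth x i \in gcomp (tnth n i)) ->
    app f x \in gcomp (\sum_(i < q) tnth n i + w).

Definition cochain (q : nat) (w : int) : {vspace multilinear q} :=
  vspace_of (fun f => alternating f /\ has_weight w f).

(* x with its i-th entry removed *)
Definition del (T : Type) (i : nat) (x : seq T) : seq T :=
  take i x ++ drop i.+1 x.

Definition diff_fun (q : nat) (f : multilinear q) (x : seq g) : g :=
  \sum_(i < q.+1) (-1) ^+ i *: bracket x`_i (app f (del i x))
  + \sum_(j < q.+1) \sum_(i < j)
      (-1) ^+ (i + j) *: app f (bracket x`_i x`_j :: del i (del j x)).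

Definition diff (q : nat) : 'Hom(multilinear q, multilinear q.+1) :=
  linfun (fun f => mk q.+1 (diff_fun f)).

Definition cocycle (q : nat) (w : int) : {vspace multilinear q} :=
  (cochain q w :&: lker (diff q))%VS.

Definition coboundary (q : nat) (w : int) : {vspace multilinear q} :=
  match q with
  | 0 => 0%VS
  | p.+1 => (diff p @: cochain p w)%VS
  end.

Definition cohom (q : nat) (w : int) : vectType K :=
  vquot (cocycle q w) (coboundary q w).

Definition cls (q : nat) (w : int) : 'Hom(multilinear q, cohom q w) :=
  vclass (cocycle q w) (coboundary q w).

(** * The Nijenhuis-Richardson bracket of 2-cochains *)

Definition circ_fun (f h : multilinear 2) (x : seq g) : g :=
  let a := x`_0 in let b := x`_1 in let c := x`_2 in
  app f [:: app h [:: a; b]; c] + app f [:: app h [:: b; c]; a]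
  + app f [:: app h [:: c; a]; b].

Definition circ (f h : multilinear 2) : multilinear 3 := mk 3 (circ_fun f h).

Definition nr (f h : multilinear 2) : multilinear 3 := circ f h + circ h f.

(* The pairing induced by [nr] on cohomology, computed on representatives;
   see [nr_pairing_cls]. *)
Definition nr_pairing (a b : int) (u : cohom 2 a) (v : cohom 2 b) :
    cohom 3 (a + b) :=
  cls 3 (a + b) (nr (vsval u) (vsval v)).

Definition nr_tensor (a b : int) :
    'Hom(tensor (cohom 2 a) (cohom 2 b), cohom 3 (a + b)) :=
  tensor_lift (@nr_pairing a b).

Definition nr_sym2 (a : int) : 'Hom(sym2 (cohom 2 a), cohom 3 (a + a)) :=
  sym2_lift (@nr_pairing a a).

End LieAlgebra.

(* Main.v *)
From HB Require Import structures.
Require Import Defs.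
From Stdlib Require Import ZArith.
From mathcomp Require Import all_boot all_order all_algebra.
From mathcomp Require Import perm boolp zify ssrZ ring.
Import GRing.Theory.
Local Open Scope ring_scope.

Set Implicit Arguments.
Unset Strict Implicit.
Unset Printing Implicit Defensive.

(** The structure constants of the algebra are integers, so everything reduces to ranks of integer
    matrices. The point is that exact ranks over K are obtained from certified lower bounds alone.

    Fix w = a + b. Let n_q be the number of elementary cochains of weight w; they span C^q_w
    ([cochain_span]), so dim C^q_w <= n_q. Let N be the span of the brackets of explicit integral
    cocycles of weights a and b. Fraction-free elimination bounds from below ([zrank_le]) the
    dimensions of d C^3_w, of B^3_w, of B^3_w + N, and of Z^2_w, the last by means of 1-coboundaries
    and explicit 2-cocycles. By rank-nullity the bound for d C^3_w bounds Z^3_w from above, and the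
    bound for Z^2_w bounds B^3_w from above. When the upper and lower bounds meet, Z^3_w = B^3_w + N
    and dim B^3_w is known ([cohom3_rank]). Hence the brackets fill H^3_w, the map is onto, and its
    rank is dim H^3_w. The four numerical conditions are instances of [rank_check], decided by
    computation.

    The transfer from Z to K is [real], which commutes with the differential ([real_diff]) and with
    the bracket ([real_nr]); in characteristic zero nonzero pivots stay nonzero ([zK_eq0]).

    For the bracket to act on classes, one needs d d = 0, that brackets of cocycles are cocycles
    ([nr_cocycle]), and that a cocycle bracketed with a coboundary is a coboundary
    ([nr_coboundary]).

    For the obstruction, if all squares of weight -2 cocycles were exact, polarisation would make
    all their brackets exact ([nr_square_eq0]); since these brackets span H^3_{-4}, that space would
    be 0 instead of 39-dimensional. *)

Section Multilinear.
Variable K : fieldType.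
Local Notation g := 'rV[K]_14.

(** * Multilinear maps and their values on basis vectors *)

Lemma bvecE n (j : 'I_14) : bvec K n 0 j = (val j == n)%:R.
Proof. by rewrite mxE. Qed.

Lemma vec_bvec (u : g) : u = \sum_(j < 14) u 0 j *: bvec K j.
Proof.
apply/rowP => l; rewrite summxE (bigD1 l) //= big1 => [|j jl].
  by rewrite mxE bvecE eqxx mulr1 addr0.
by rewrite mxE bvecE eq_sym (inj_eq val_inj) (negPf jl) mulr0.
Qed.

Lemma app_basis q (f : multilinear K q) (t : q.-tuple 'I_14) :
  app f [seq bvec K (val i) | i <- t] = (f : {ffun _ -> g}) t.
Proof.
rewrite /app (bigD1 t) //= [X in _ + X]big1 ?addr0 => [|u ut].
  rewrite big1 ?scale1r // => i _.
  by rewrite (nth_map (tnth t i)) ?size_tuple // bvecE -tnth_nth eqxx.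
have [i iut] : exists i, tnth u i != tnth t i.
  apply/existsP; apply: contraNT ut; rewrite negb_exists => /forallP ut.
  by apply/eqP/eq_from_tnth => i; apply/eqP; have := ut i; rewrite negbK.
rewrite (bigD1 i) //= (nth_map (tnth t i)) ?size_tuple // bvecE -tnth_nth.
by rewrite (inj_eq val_inj) (negPf iut) mul0r scale0r.
Qed.

Lemma app_linear q (x : seq g) a (f h : multilinear K q) :
  app (a *: f + h) x = a *: app f x + app h x.
Proof.
rewrite /app scaler_sumr -big_split; apply: eq_bigr => t _ /=.
by rewrite !ffunE scalerDr !scalerA mulrC.
Qed.

Lemma app_slot q (f : multilinear K q) (s1 s2 : seq g) a u v :
  (size s1 < q)%N ->
  app f (s1 ++ (a *: u + v) :: s2) =
    a *: app f (s1 ++ u :: s2) + app f (s1 ++ v :: s2).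
Proof.
move=> s1q; rewrite /app scaler_sumr -big_split; apply: eq_bigr => t _ /=.
rewrite scalerA -scalerDl; congr (_ *: _).
pose i0 := Ordinal s1q.
have nths w (i : 'I_q) : i != i0 ->
    (s1 ++ w :: s2)`_i = (s1 ++ (a *: u + v) :: s2)`_i.
  move=> ii0; rewrite !nth_cat; case: ltnP => // le_s1.
  have : (0 < i - size s1)%N.
    by rewrite subn_gt0 ltn_neqAle le_s1 andbT eq_sym.
  by case: (_ - _)%N.
have nth0 w : (s1 ++ w :: s2)`_i0 = w by rewrite nth_cat ltnn subnn.
rewrite !(bigD1 i0 (P := predT)) //= !nth0 !mxE.
have rest w : \prod_(i < q | i != i0) (s1 ++ w :: s2)`_i 0 (tnth t i) =
    \prod_(i < q | i != i0) (s1 ++ (a *: u + v) :: s2)`_i 0 (tnth t i).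
  by apply: eq_bigr => i /nths ->.
by rewrite (rest u) (rest v) mulrDl mulrA.
Qed.

(* A multilinear map of lists of q vectors is the one stored by its values on
   the basis. *)
Lemma app_mk q (F : seq g -> g) :
  (forall s1 s2 a u v, (size s1 + size s2).+1 = q ->
     F (s1 ++ (a *: u + v) :: s2) =
       a *: F (s1 ++ u :: s2) + F (s1 ++ v :: s2)) ->
  forall x, size x = q -> app (mk q F) x = F x.
Proof.
move=> linF.
have F0 s1 s2 : (size s1 + size s2).+1 = q -> F (s1 ++ 0 :: s2) = 0.
  by move=> sq; have := linF s1 s2 (-1) 0 0 sq; rewrite scaler0 addr0 scaleN1r addNr.
have Fsum (J : Type) (r : seq J) (c : J -> K) (w : J -> g) s1 s2 :
    (size s1 + size s2).+1 = q ->
    F (s1 ++ (\sum_(j <- r) c j *: w j) :: s2) =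
      \sum_(j <- r) c j *: F (s1 ++ w j :: s2).
  move=> sq; elim: r => [|j r IH]; first by rewrite !big_nil F0.
  by rewrite !big_cons linF // IH.
(* The slots are expanded in the basis one at a time, from the left; [s1] collects the slots already
   treated. *)
suff expand n (y s1 : seq g) : size y = n -> (size s1 + n)%N = q ->
    F (s1 ++ y) = \sum_(t : n.-tuple 'I_14)
      (\prod_(i < n) y`_i 0 (tnth t i)) *:
        F (s1 ++ [seq bvec K (val i) | i <- t]).
  move=> x sx; rewrite -(cat0s x) (expand q) // /app.
  by apply: eq_bigr => t _; rewrite /mk ffunE.
elim: n y s1 => [|n IH] [|u y] //= s1 => [_ _|[sy] sq].
  rewrite (big_pred1 [tuple]) => [|t]; first by rewrite big_ord0 scale1r.
  by apply/esym/eqP; rewrite [t]tuple0; apply: val_inj.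
rewrite {1}(vec_bvec u) Fsum ?sy -?addnS //.
rewrite (reindex (fun p : 'I_14 * n.-tuple 'I_14 => [tuple of p.1 :: p.2])) /=;
  last first.
  exists (fun t => (thead t, [tuple of behead t])) => [[i t] _|t _] /=.
    by congr pair; apply: val_inj.
  by rewrite -tuple_eta.
rewrite -(pair_bigA _ (fun i (t : n.-tuple 'I_14) =>
  (\prod_(k < n.+1) (u :: y)`_k 0 (tnth [tuple of i :: t] k)) *:
    F (s1 ++ [seq bvec K (val k) | k <- i :: t]))) /=.
apply: eq_bigr => i _.
rewrite -cat_rcons IH ?size_rcons ?addSnnS // scaler_sumr.
apply: eq_bigr => t _; rewrite scalerA big_ord_recl /= tnth0 cat_rcons.
congr (_ * _ *: _); apply: eq_bigr => k _.
by rewrite tnthS.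
Qed.

End Multilinear.

(* Integral vectors are formal sums: the pair (c, n) stands for c times the
   n-th basis vector. *)
Notation fsum := (seq (Z * nat)).

(** * Integer model of the bracket, and the graded Lie algebra axioms *)

Definition fscale (c : Z) (s : fsum) : fsum := [seq (Z.mul c p.1, p.2) | p <- s].

Definition fbind (s : fsum) (F : nat -> fsum) : fsum :=
  flatten [seq fscale p.1 (F p.2) | p <- s].

Fixpoint fcoef (l : nat) (s : fsum) : Z :=
  if s is (c, n) :: s' then
    if eqn n l then Z.add c (fcoef l s') else fcoef l s'
  else Z0.

(** Literal tables, so that computation meets neither field elements nor [monomials]. The empty
    entry at index 10 encodes Z_{x^2y^2} = 0; in [fadY] this is the one at index 9. *)
Definition fadX (j : nat) : fsum :=
  nth [::] [:: [::]; [:: (Zpos xH, 2)]; [:: (Zpos xH, 3)]; [:: (Zpos xH, 5)];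
    [:: (Zpos xH, 6)]; [:: (Zpos xH, 8)]; [:: (Zpos xH, 9)]; [:: (Zpos xH, 10)];
    [:: (Zpos xH, 12)]; [:: (Zpos xH, 13)]; [::]; [:: (Zpos xH, 13)]] j.

Definition fadY (j : nat) : fsum :=
  nth [::] [:: [:: (Zneg xH, 2)]; [::]; [:: (Zpos xH, 4)]; [:: (Zpos xH, 6)];
    [:: (Zpos xH, 7)]; [:: (Zpos xH, 9)]; [:: (Zpos xH, 10)]; [:: (Zpos xH, 11)];
    [:: (Zpos xH, 13)]; [::]; [:: (Zpos xH, 13)]; [:: (Zpos xH, 12)]] j.

Definition fbr (i j : nat) : fsum :=
  match i, j with
  | 0, _ => fadX j
  | 1, _ => fadY j
  | _, 0 => fscale (-1) (fadX i)
  | _, 1 => fscale (-1) (fadY i)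
  | _, _ => [::]
  end%N.

(** [bdeg] on plain numbers; on ordinals the two are convertible, and later proofs exchange them by
    conversion. *)
Definition fdeg (i : nat) : nat :=
  nth 0%N [:: 1; 1; 2; 3; 3; 4; 4; 4; 5; 5; 5; 5; 6; 6]%N i.

Section Bracket.
Variable K : fieldType.
Local Notation g := 'rV[K]_14.

Definition zK (z : Z) : K := (int_of_Z z)%:~R.

Lemma zK0 : zK 0 = 0. Proof. by []. Qed.
Lemma zK1 : zK 1 = 1. Proof. by []. Qed.
Lemma zKN1 : zK (-1) = -1. Proof. by []. Qed.
Lemma zKD y z : zK (Z.add y z) = zK y + zK z.
Proof. by rewrite /zK -[Z.add y z]/(y + z) !rmorphD. Qed.
Lemma zKN z : zK (Z.opp z) = - zK z.
Proof. by rewrite /zK -[Z.opp z]/(- z) !rmorphN. Qed.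
Lemma zKM y z : zK (Z.mul y z) = zK y * zK z.
Proof. by rewrite /zK -[Z.mul y z]/(y * z) !rmorphM. Qed.

(** The only place where elimination over Z meets the characteristic of K: a nonzero integer pivot
    remains a nonzero scalar. *)
Lemma zK_eq0 (charK : [pchar K] =i pred0) z : (zK z == 0) = (z == 0).
Proof.
have /pcharf0P natK := charK.
rewrite /zK -[z in RHS]int_of_ZK; case: (int_of_Z z) => n.
  by rewrite -pmulrn natK; case: n.
by rewrite NegzE mulrNz oppr_eq0 -pmulrn natK; lia.
Qed.

Definition vec (s : fsum) : g := \sum_(p <- s) zK p.1 *: bvec K p.2.

Lemma vec_nil : vec [::] = 0. Proof. exact: big_nil. Qed.

Lemma vec1 n : vec [:: (Zpos xH, n)] = bvec K n.
Proof. by rewrite /vec big_seq1 zK1 scale1r. Qed.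

Lemma vec_cat s t : vec (s ++ t) = vec s + vec t.
Proof. exact: big_cat. Qed.

Lemma vec_scale c s : vec (fscale c s) = zK c *: vec s.
Proof.
rewrite /vec big_map scaler_sumr; apply: eq_bigr => p _ /=.
by rewrite zKM scalerA.
Qed.

Lemma vec_bind s F : vec (fbind s F) = \sum_(p <- s) zK p.1 *: vec (F p.2).
Proof.
elim: s => [|p s IH]; first by rewrite big_nil vec_nil.
by rewrite /fbind /= vec_cat vec_scale big_cons IH.
Qed.

Lemma vec_coef s (l : 'I_14) : vec s 0 l = zK (fcoef l s).
Proof.
elim: s => [|[c n] s IH]; first by rewrite vec_nil mxE.
rewrite /vec big_cons -/(vec s) !mxE IH /= eqnE eq_sym.
by case: eqP => _; rewrite ?mulr1 ?mulr0 ?add0r ?zKD.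
Qed.

Lemma vec_eq s t : all (fun l => fcoef l s == fcoef l t) (iota 0 14) ->
  vec s = vec t.
Proof.
move=> /allP eq_st; apply/rowP => l.
have /eqP e : fcoef l s == fcoef l t.
  by apply: eq_st; rewrite mem_iota ltn_ord.
by rewrite !vec_coef e.
Qed.

Lemma basis_bracketE i j : basis_bracket K i j = vec (fbr i j).
Proof.
have vecN s : vec (fscale (-1) s) = - vec s.
  by rewrite vec_scale zKN1 scaleN1r.
have vecN1 n : vec [:: (Zneg xH, n)] = - bvec K n.
  by rewrite /vec big_seq1 zKN1 scaleN1r.
have EX n : adX K n = vec (fadX n).
  by do 12![case: n => [|n]; first by rewrite /adX /Zvec /fadX /= ?vec1 ?vec_nil]; rewrite /fadX /= nth_nil vec_nil.
have EY n : adY K n = vec (fadY n).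
  by do 12![case: n => [|n]; first by rewrite /adY /Zvec /fadY /= ?vec1 ?vecN1 ?vec_nil];
    rewrite /fadY /= nth_nil vec_nil.
by case: i j => [|[|i]] [|[|j]]; rewrite /basis_bracket /fbr ?EX ?EY ?vecN ?vec_nil.
Qed.

Lemma bracket_lineal (a : K) (u v w : g) :
  bracket (a *: u + v) w = a *: bracket u w + bracket v w.
Proof.
rewrite /bracket scaler_sumr -big_split; apply: eq_bigr => i _ /=.
rewrite scaler_sumr -big_split; apply: eq_bigr => j _ /=.
by rewrite !mxE scalerA -scalerDl mulrDl mulrA.
Qed.

Lemma bracket_linear (w : g) : linear (bracket w).
Proof.
move=> a u v; rewrite /bracket scaler_sumr -big_split; apply: eq_bigr => i _ /=.
rewrite scaler_sumr -big_split; apply: eq_bigr => j _ /=.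
by rewrite !mxE scalerA -scalerDl; congr (_ *: _); ring.
Qed.

Lemma bracket_bvec (i j : 'I_14) :
  bracket (bvec K i) (bvec K j) = vec (fbr i j).
Proof.
have off (k l : 'I_14) : k != l -> bvec K l 0 k = 0.
  by move=> kl; rewrite bvecE (inj_eq val_inj) (negPf kl).
rewrite /bracket (bigD1 i) //= [X in _ + X]big1 ?addr0 => [|k ki].
  rewrite (bigD1 j) //= [X in _ + X]big1 ?addr0 => [|l lj].
    by rewrite !bvecE !eqxx mulr1 scale1r basis_bracketE.
  by rewrite (off _ _ lj) mulr0 scale0r.
by rewrite big1 // => l _; rewrite (off _ _ ki) mul0r scale0r.
Qed.

HB.instance Definition _ (w : g) :=
  GRing.isLinear.Build K g g *:%R (bracket w) (bracket_linear w).

Lemma bracketDr (u v w : g) : bracket u (v + w) = bracket u v + bracket u w.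
Proof. exact: linearD. Qed.
Lemma bracketNr (u v : g) : bracket u (- v) = - bracket u v.
Proof. exact: linearN. Qed.
Lemma bracketZr (u v : g) a : bracket u (a *: v) = a *: bracket u v.
Proof. exact: linearZ. Qed.
Lemma bracket0r (u : g) : bracket u 0 = 0. Proof. exact: linear0. Qed.

Lemma bracket_vec (i : 'I_14) s :
  all (fun p => p.2 < 14)%N s ->
  bracket (bvec K i) (vec s) = vec (fbind s (fbr i)).
Proof.
rewrite vec_bind {1}/vec linear_sum => /allP s14.
apply: eq_big_seq => p /s14 p14 /=.
by rewrite bracketZr (bracket_bvec i (Ordinal p14)).
Qed.

(** Reduces a multilinear identity to the finitely many basis tuples, where the integer tables
    decide it by computation. Antisymmetry and the Jacobi identity are proved this way. *)
Lemma multilinear_eq0 q (F : seq g -> g) :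
  (forall s1 s2 a u v, (size s1 + size s2).+1 = q ->
     F (s1 ++ (a *: u + v) :: s2) =
       a *: F (s1 ++ u :: s2) + F (s1 ++ v :: s2)) ->
  (forall t : q.-tuple 'I_14, F [seq bvec K (val i) | i <- t] = 0) ->
  forall x, size x = q -> F x = 0.
Proof.
move=> linF F0 x sx; rewrite -(app_mk linF) // /app big1 // => t _.
by rewrite /mk ffunE F0 scaler0.
Qed.

Lemma all_ord14 (p : nat -> bool) :
  all p (iota 0 14) -> forall i : 'I_14, p i.
Proof. by move=> /allP h i; apply: h; rewrite mem_iota ltn_ord. Qed.

Lemma fbr_lt14 (a b : 'I_14) : all (fun p => p.2 < 14)%N (fbr a b).
Proof.
suff /all_ord14/(_ a)/all_ord14/(_ b) : all (fun i => all (fun j =>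
  all (fun p => p.2 < 14)%N (fbr i j)) (iota 0 14)) (iota 0 14) by [].
by vm_compute.
Qed.

Lemma bracketC (u v : g) : bracket u v = - bracket v u.
Proof.
apply/eqP; rewrite -addr_eq0; apply/eqP.
apply: (multilinear_eq0 (q := 2)
  (F := fun x : seq g => bracket x`_0 x`_1 + bracket x`_1 x`_0) _ _
  (erefl : size [:: u; v] = 2%N)).
  case=> [|y [|z s1]] [|z2 [|z3 s2]] //= a u1 v1 _;
  by rewrite bracket_lineal linearP scalerDr addrACA.
move=> [[|i [|j [|]]] //= _]; rewrite !bracket_bvec -vec_cat -vec_nil.
apply: vec_eq.
suff /all_ord14/(_ i)/all_ord14/(_ j) : all (fun i => all (fun j =>
  all (fun l => fcoef l (fbr i j ++ fbr j i) == fcoef l [::])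
  (iota 0 14)) (iota 0 14)) (iota 0 14) by [].
by vm_compute.
Qed.

Lemma jacobi (u v w : g) :
  bracket u (bracket v w) = bracket (bracket u v) w + bracket v (bracket u w).
Proof.
apply/eqP; rewrite -subr_eq0; apply/eqP.
apply: (multilinear_eq0 (q := 3) (F := fun x : seq g =>
  bracket x`_0 (bracket x`_1 x`_2) -
    (bracket (bracket x`_0 x`_1) x`_2 + bracket x`_1 (bracket x`_0 x`_2)))
  _ _ (erefl : size [:: u; v; w] = 3%N)).
  move=> [|y [|z [|t s1]]] [|z2 [|z3 [|z4 s2]]] //= a u1 v1 _;
    rewrite !(bracket_lineal, bracketDr, bracketZr) !(scalerBr, scalerDr);
    by apply/rowP => l; rewrite !mxE; ring.
move=> [[|i [|j [|k [|]]]] //= _]; apply/eqP; rewrite subr_eq0; apply/eqP.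
have br14 := fbr_lt14.
rewrite !bracket_bvec [X in _ = X + _]bracketC !bracket_vec //.
rewrite -[- _]scaleN1r -zKN1 -vec_scale -vec_cat.
apply: vec_eq.
suff /all_ord14/(_ i)/all_ord14/(_ j)/all_ord14/(_ k) :
  all (fun i => all (fun j => all (fun k => all (fun l =>
    fcoef l (fbind (fbr j k) (fbr i)) ==
    fcoef l (fscale (-1) (fbind (fbr i j) (fbr k)) ++ fbind (fbr i k) (fbr j)))
  (iota 0 14)) (iota 0 14)) (iota 0 14)) (iota 0 14) by [].
by vm_compute.
Qed.

Lemma bracketvv (charK : [pchar K] =i pred0) (u : g) : bracket u u = 0.
Proof.
have two0 : (2%:R : K) != 0 by move: charK => /pcharf0P ->.
apply/eqP; have := bracketC u u => /eqP.
by rewrite -addr_eq0 -mulr2n -scaler_nat scaler_eq0 (negPf two0).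
Qed.

Lemma mem_gcomp n (u : g) :
  reflect (forall l : 'I_14, u 0 l != 0 -> (bdeg l)%:Z = n) (u \in gcomp K n).
Proof.
apply: (iffP idP) => [/memv_sumP [v vi ->] l|un].
  apply: contraNeq => /eqP ln; rewrite summxE big1 // => i /eqP di.
  have /vlineP [a ->] := vi i (introT eqP di).
  rewrite !mxE; case: eqP => [/val_inj li|]; last by rewrite mulr0.
  by case: ln; rewrite li.
rewrite (vec_bvec u) (bigID (fun l : 'I_14 => (bdeg l)%:Z == n)) /=.
rewrite addrC big1 ?add0r => [|l ln].
  by apply: memv_sumr => l ln; rewrite memvZ // memv_line.
have [->|/un dl] := eqVneq (u 0 l) 0; first by rewrite scale0r.
by rewrite dl eqxx in ln.
Qed.

Lemma bvec_gcomp (l : 'I_14) : bvec K l \in gcomp K (bdeg l).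
Proof.
apply/mem_gcomp => k; rewrite bvecE; case: (val k =P val l) => [e _|_ /eqP //].
by rewrite (val_inj e).
Qed.

Lemma bracket_gcomp m n (u v : g) : u \in gcomp K m -> v \in gcomp K n ->
  bracket u v \in gcomp K (m + n).
Proof.
move=> /mem_gcomp um /mem_gcomp vn; rewrite /bracket.
apply: rpred_sum => i _; apply: rpred_sum => j _.
have [->|ui] := eqVneq (u 0 i) 0; first by rewrite mul0r scale0r mem0v.
have [->|vj] := eqVneq (v 0 j) 0; first by rewrite mulr0 scale0r mem0v.
rewrite -(um i ui) -(vn j vj) memvZ // basis_bracketE.
apply/mem_gcomp => l.
rewrite vec_coef; have [->|cl _] := eqVneq (fcoef l (fbr i j)) 0.
  by rewrite zK0 eqxx.
suff /all_ord14/(_ i)/all_ord14/(_ j)/all_ord14/(_ l) :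
  all (fun i => all (fun j => all (fun l => (fcoef l (fbr i j) != 0) ==>
    (fdeg l == fdeg i + fdeg j)%N) (iota 0 14)) (iota 0 14)) (iota 0 14).
  by rewrite cl => /eqP e; rewrite -PoszD; congr Posz.
by vm_compute.
Qed.

End Bracket.

(** * The differential in low degrees, and d d = 0 *)

Section Identities.
Variable K : fieldType.
Local Notation g := 'rV[K]_14.

(** A bundle of rewrite rules for one slot; its instances, gathered in [linE], push all sums and
    scalars out of arguments so that [ring] can finish coordinatewise. *)
Lemma app_slotE q (f : multilinear K q) (s1 s2 : seq g) : (size s1 < q)%N ->
  ((forall u v, app f (s1 ++ (u + v) :: s2) =
      app f (s1 ++ u :: s2) + app f (s1 ++ v :: s2)) *
   (forall u, app f (s1 ++ (- u) :: s2) = - app f (s1 ++ u :: s2)) *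
   (forall a u, app f (s1 ++ (a *: u) :: s2) = a *: app f (s1 ++ u :: s2)) *
   (app f (s1 ++ 0 :: s2) = 0)).
Proof.
move=> s1q; have lin a u v := app_slot f s2 a u v s1q.
have f0 : app f (s1 ++ 0 :: s2) = 0.
  by have := lin (-1) 0 0; rewrite scaler0 addr0 scaleN1r addNr.
split=> //; split=> [|a u]; last by rewrite -[a *: u]addr0 lin f0 addr0.
split=> [u v|u]; first by rewrite -[u in LHS]scale1r lin scale1r.
by rewrite -[- u]addr0 -scaleN1r lin f0 addr0 scaleN1r.
Qed.

Definition app1E (f : multilinear K 1) := app_slotE f (s1 := [::]) [::] isT.
Definition app2l (f : multilinear K 2) b := app_slotE f (s1 := [::]) [:: b] isT.
Definition app2r (f : multilinear K 2) a := app_slotE f (s1 := [:: a]) [::] isT.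
Definition app3l (f : multilinear K 3) b c :=
  app_slotE f (s1 := [::]) [:: b; c] isT.
Definition app3m (f : multilinear K 3) a c :=
  app_slotE f (s1 := [:: a]) [:: c] isT.
Definition app3r (f : multilinear K 3) a b :=
  app_slotE f (s1 := [:: a; b]) [::] isT.

Definition bracketl (w : g) :
  ((forall u v, bracket (u + v) w = bracket u w + bracket v w) *
   (forall u, bracket (- u) w = - bracket u w) *
   (forall a u, bracket (a *: u) w = a *: bracket u w) *
   (bracket 0 w = 0)).
Proof.
split; last by rewrite bracketC bracket0r oppr0.
split=> [|a u]; last by rewrite bracketC bracketZr -scalerN -bracketC.
split=> [u v|u]; first by rewrite bracketC bracketDr opprD -!bracketC.
by rewrite bracketC bracketNr -bracketC.
Qed.

Definition linE := (app1E, app2l, app2r, app3l, app3m, app3r, bracketl,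
  (@bracketDr K, @bracketNr K, @bracketZr K)).

Lemma diff_fun1 (b : multilinear K 1) (u v : g) :
  diff_fun b [:: u; v] = bracket u (app b [:: v]) - bracket v (app b [:: u])
    - app b [:: bracket u v].
Proof.
rewrite /diff_fun !(big_ord_recl, big_ord0) /=.
by rewrite /bump /= !addr0 !add0r expr0 expr1 !scale1r !scaleN1r.
Qed.

Lemma diff_fun2 (f : multilinear K 2) (u v w : g) :
  diff_fun f [:: u; v; w] =
    bracket u (app f [:: v; w]) - bracket v (app f [:: u; w])
    + bracket w (app f [:: u; v]) - app f [:: bracket u v; w]
    + app f [:: bracket u w; v] - app f [:: bracket v w; u].
Proof.
rewrite /diff_fun !(big_ord_recl, big_ord0) /=.
rewrite /bump /= !addr0 !add0r.
by apply/rowP => l; rewrite !mxE; ring.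
Qed.

Lemma diff_fun3 (f : multilinear K 3) (a b c d : g) :
  diff_fun f [:: a; b; c; d] =
    bracket a (app f [:: b; c; d]) - bracket b (app f [:: a; c; d])
    + bracket c (app f [:: a; b; d]) - bracket d (app f [:: a; b; c])
    - app f [:: bracket a b; c; d] + app f [:: bracket a c; b; d]
    - app f [:: bracket a d; b; c] - app f [:: bracket b c; a; d]
    + app f [:: bracket b d; a; c] - app f [:: bracket c d; a; b].
Proof.
rewrite /diff_fun !(big_ord_recl, big_ord0) /=.
rewrite /bump /= !addr0 !add0r.
by apply/rowP => l; rewrite !mxE; ring.
Qed.

Lemma diffE q (f : multilinear K q) : diff K q f = mk q.+1 (diff_fun f).
Proof.
rewrite /diff linfunE // => a f1 f2; apply/ffunP => t; rewrite !ffunE.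
rewrite /diff_fun scalerDr addrACA; congr (_ + _);
  rewrite scaler_sumr -big_split; apply: eq_bigr => i _ /=.
  by rewrite app_linear bracketDr bracketZr scalerDr !scalerA mulrC.
rewrite scaler_sumr -big_split; apply: eq_bigr => j _ /=.
by rewrite app_linear scalerDr !scalerA mulrC.
Qed.

Lemma app_diff1 (b : multilinear K 1) u v :
  app (diff K 1 b) [:: u; v] = bracket u (app b [:: v])
    - bracket v (app b [:: u]) - app b [:: bracket u v].
Proof.
rewrite diffE app_mk ?diff_fun1 // => -[|x [|y s1]] [|z [|t s2]] //= a u1 v1 _;
  rewrite !diff_fun1 !linE; apply/rowP => l; rewrite !mxE; ring.
Qed.

Lemma app_diff2 (f : multilinear K 2) u v w :
  app (diff K 2 f) [:: u; v; w] =
    bracket u (app f [:: v; w]) - bracket v (app f [:: u; w])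
    + bracket w (app f [:: u; v]) - app f [:: bracket u v; w]
    + app f [:: bracket u w; v] - app f [:: bracket v w; u].
Proof.
rewrite diffE app_mk ?diff_fun2 //.
move=> [|x [|y [|r s1]]] [|z [|t [|t2 s2]]] //= a u1 v1 _;
  rewrite !diff_fun2 !linE; apply/rowP => l; rewrite !mxE; ring.
Qed.

Lemma app_nr (f h : multilinear K 2) a b c :
  app (nr f h) [:: a; b; c] =
    app f [:: app h [:: a; b]; c] + app f [:: app h [:: b; c]; a]
    + app f [:: app h [:: c; a]; b]
    + (app h [:: app f [:: a; b]; c] + app h [:: app f [:: b; c]; a]
    + app h [:: app f [:: c; a]; b]).
Proof.
have app_circ (f1 h1 : multilinear K 2) : app (circ f1 h1) [:: a; b; c] =
    app f1 [:: app h1 [:: a; b]; c] + app f1 [:: app h1 [:: b; c]; a]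
    + app f1 [:: app h1 [:: c; a]; b].
  rewrite /circ app_mk //.
  move=> [|x [|y [|r s1]]] [|z [|t [|t2 s2]]] //= k u1 v1 _;
  rewrite /circ_fun /= !linE; apply/rowP => l; rewrite !mxE; ring.
by rewrite /nr -[circ f h]scale1r app_linear scale1r !app_circ.
Qed.

Lemma multilinear_eq q (f h : multilinear K q) :
  (forall x : q.-tuple g, app f x = app h x) -> f = h.
Proof.
move=> fh; apply/ffunP => t; rewrite -!app_basis.
exact: (fh [tuple of [seq bvec K (val i) | i <- t]]).
Qed.

Lemma jacobi_l (x y z : g) :
  bracket (bracket y z) x = - bracket (bracket x y) z - bracket y (bracket x z).
Proof. by rewrite bracketC jacobi opprD. Qed.

Lemma diff_diff1 (b : multilinear K 1) : diff K 2 (diff K 1 b) = 0.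
Proof.
apply/ffunP => t; rewrite diffE !ffunE; case: t => [[|i [|j [|k [|]]]] //= _].
rewrite diff_fun2 !app_diff1; set x := bvec K i; set y := bvec K j.
set z := bvec K k; rewrite !linE.
rewrite (jacobi x y (app _ _)) (jacobi x z (app _ _)) (jacobi y z (app _ _)).
rewrite (jacobi_l x y z) (bracketC (bracket x z) y) !linE.
by apply/rowP => l; rewrite !mxE; ring.
Qed.

Lemma alternatingC (f : multilinear K 2) a b :
  alternating f -> app f [:: a; b] = - app f [:: b; a].
Proof.
move=> altf; have f0 u : app f [:: u; u] = 0.
  by apply: (altf [tuple u; u]); rewrite /= inE eqxx.
have := f0 (a + b); rewrite !linE !f0 add0r addr0 => /eqP.
by rewrite addr_eq0 => /eqP.
Qed.

(** The terms with one outer bracket cancel by Jacobi in the module, those with a nested bracket by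
    Jacobi among the arguments, and those of the form f([.,.],[.,.]) in pairs by alternation, which
    is why alternation is assumed here and not in degree 1. *)
Lemma diff_diff2 (f : multilinear K 2) :
  alternating f -> diff K 3 (diff K 2 f) = 0.
Proof.
move=> altf; apply/ffunP => t; rewrite diffE !ffunE.
case: t => [[|i [|j [|k [|m [|]]]]] //= _].
rewrite diff_fun3 !app_diff2; set a := bvec K i; set b := bvec K j.
set c := bvec K k; set d := bvec K m; rewrite !linE.
rewrite (jacobi a b (app _ _)) (jacobi a c (app _ _)) (jacobi a d (app _ _)).
rewrite (jacobi b c (app _ _)) (jacobi b d (app _ _)) (jacobi c d (app _ _)).
rewrite (jacobi_l a b c) (bracketC (bracket a c) b).
rewrite (jacobi_l a b d) (bracketC (bracket a d) b).
rewrite (jacobi_l a c d) (bracketC (bracket a d) c).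
rewrite (jacobi_l b c d) (bracketC (bracket b d) c) !linE.
rewrite (alternatingC (bracket c d) (bracket a b) altf).
rewrite (alternatingC (bracket b d) (bracket a c) altf).
rewrite (alternatingC (bracket b c) (bracket a d) altf).
by apply/rowP => l; rewrite !mxE; ring.
Qed.

End Identities.

(** * The Nijenhuis-Richardson bracket against the differential *)

Section NR.
Variable K : fieldType.
Local Notation g := 'rV[K]_14.

(* The Nijenhuis-Richardson bracket of a 2-cochain with a 1-cochain. *)
Definition nr1 (f : multilinear K 2) (b : multilinear K 1) : multilinear K 2 :=
  mk 2 (fun x => app f [:: app b [:: x`_0]; x`_1]
    + app f [:: x`_0; app b [:: x`_1]] - app b [:: app f [:: x`_0; x`_1]]).

Lemma app_nr1 (f : multilinear K 2) (b : multilinear K 1) u v :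
  app (nr1 f b) [:: u; v] = app f [:: app b [:: u]; v]
    + app f [:: u; app b [:: v]] - app b [:: app f [:: u; v]].
Proof.
rewrite app_mk // => -[|x [|y s1]] [|z [|t s2]] //= a u1 v1 _;
  rewrite !linE; apply/rowP => l; rewrite !mxE; ring.
Qed.

(** For any alternating f the two sides differ by b composed with df minus df with b inserted in
    each slot, and this vanishes when f is closed. *)
Lemma nr_coboundary (f : multilinear K 2) (b : multilinear K 1) :
  alternating f -> diff K 2 f = 0 -> nr f (diff K 1 b) = diff K 2 (nr1 f b).
Proof.
move=> altf df0; apply: multilinear_eq => -[[|x [|y [|z [|]]]] //= _].
have app0 q (s : seq g) : app (0 : multilinear K q) s = 0.
  by rewrite /app big1 // => t _; rewrite ffunE scaler0.
have D0 : app b [:: app (diff K 2 f) [:: x; y; z]]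
    - app (diff K 2 f) [:: app b [:: x]; y; z]
    + app (diff K 2 f) [:: app b [:: y]; x; z]
    - app (diff K 2 f) [:: app b [:: z]; x; y] = 0.
  by rewrite df0 !app0 !linE !(addr0, subr0).
apply/eqP; rewrite -subr_eq0 -D0; apply/eqP.
rewrite app_nr !app_diff1 !app_diff2 !app_nr1 !linE.
have fC u v : app f [:: u; v] = - app f [:: v; u] by exact: alternatingC.
rewrite (bracketC z x) (fC z x) !linE.
(* Antisymmetry is used to give each term one fixed orientation, so that [ring] sees equal terms as
   equal atoms. *)
have fb u v : app f [:: u; app b [:: v]] = - app f [:: app b [:: v]; u].
  exact: fC.
have brb u v : bracket (app b [:: u]) v = - bracket v (app b [:: u]).
  exact: bracketC.
rewrite !fb !brb.
have brf : ((forall u v, bracket (app f [:: u; v]) x =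
      - bracket x (app f [:: u; v])) *
    (forall u v, bracket (app f [:: u; v]) y = - bracket y (app f [:: u; v])) *
    (forall u v, bracket (app f [:: u; v]) z = - bracket z (app f [:: u; v])))%type.
  by do !split; move=> *; exact: bracketC.
rewrite !brf !linE.
by apply/rowP => l; rewrite !mxE; ring.
Qed.

End NR.

Section NR.
Variable K : fieldType.
Local Notation g := 'rV[K]_14.

(** The derivation property of d for this bracket: d[f,h] is a signed sum of insertions of df and dh
    into h and f and conversely, hence zero on cocycles. *)
Lemma nr_cocycle (f h : multilinear K 2) :
    alternating f -> alternating h -> diff K 2 f = 0 -> diff K 2 h = 0 ->
  diff K 3 (nr f h) = 0.
Proof.
move=> altf alth df0 dh0; apply/ffunP => t; rewrite diffE !ffunE.
case: t => [[|i [|j [|k [|m [|]]]]] //= _].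
set a := bvec K i; set b := bvec K j; set c := bvec K k; set d := bvec K m.
have app0 q (x : seq g) : app (0 : multilinear K q) x = 0.
  by rewrite /app big1 // => t _; rewrite ffunE scaler0.
(* [S p r] inserts r into dp over the six pairs of arguments, and dr into p over the four triples;
   d[f,h] is -(S f h + S h f) at (a,b,c,d). *)
pose S (p r : multilinear K 2) :=
  app (diff K 2 p) [:: app r [:: a; b]; c; d]
  - app (diff K 2 p) [:: app r [:: a; c]; b; d]
  + app (diff K 2 p) [:: app r [:: a; d]; b; c]
  + app (diff K 2 p) [:: app r [:: b; c]; a; d]
  - app (diff K 2 p) [:: app r [:: b; d]; a; c]
  + app (diff K 2 p) [:: app r [:: c; d]; a; b]
  + app p [:: app (diff K 2 r) [:: b; c; d]; a]
  - app p [:: app (diff K 2 r) [:: a; c; d]; b]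
  + app p [:: app (diff K 2 r) [:: a; b; d]; c]
  - app p [:: app (diff K 2 r) [:: a; b; c]; d].
transitivity (- (S f h + S h f)); last first.
  by rewrite /S df0 dh0 !app0 !linE !(addr0, subr0, oppr0).
rewrite /S diff_fun3 !app_diff2 !app_nr !linE.
have C (p : multilinear K 2) x y : alternating p -> app p [:: x; y] = - app p [:: y; x].
  exact: alternatingC.
(* As before, a normal orientation for each pair of arguments, here for both cochains at once. *)
have orient (p r : multilinear K 2) : alternating p -> alternating r ->
  ((app p [:: c; a] = - app p [:: a; c]) *
   (app p [:: d; a] = - app p [:: a; d]) *
   (app p [:: c; b] = - app p [:: b; c]) *
   (app p [:: d; b] = - app p [:: b; d]) *
   (forall x y, app p [:: a; bracket x y] = - app p [:: bracket x y; a]) *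
   (forall x y, app p [:: b; bracket x y] = - app p [:: bracket x y; b]) *
   (forall x y, app p [:: c; bracket x y] = - app p [:: bracket x y; c]) *
   (forall x y, app p [:: d; bracket x y] = - app p [:: bracket x y; d]) *
   (forall x y u v, app p [:: bracket u v; app r [:: x; y]] = 
      - app p [:: app r [:: x; y]; bracket u v]))%type.
  by move=> altp altr; do !split; move=> *; exact: C.
have orientb (r : multilinear K 2) :
  ((forall x y, bracket (app r [:: x; y]) a = - bracket a (app r [:: x; y])) *
   (forall x y, bracket (app r [:: x; y]) b = - bracket b (app r [:: x; y])) *
   (forall x y, bracket (app r [:: x; y]) c = - bracket c (app r [:: x; y])) *
   (forall x y, bracket (app r [:: x; y]) d = - bracket d (app r [:: x; y])))%type.
  by do !split; move=> *; exact: bracketC.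
rewrite !(orient f h) // !(orient h f) // !(orientb f) !(orientb h) !linE.
have hf x y u v : bracket (app h [:: x; y]) (app f [:: u; v]) =
    - bracket (app f [:: u; v]) (app h [:: x; y]) by exact: bracketC.
rewrite !hf.
by apply/rowP => l; rewrite !mxE; ring.
Qed.


End NR.

(** * Alternation and weight of differentials and brackets *)

Section Cochains.
Variable K : fieldType.
Hypothesis charK : [pchar K] =i pred0.
Local Notation g := 'rV[K]_14.

Lemma mem_cochain q w (f : multilinear K q) :
  f \in cochain K q w <-> alternating f /\ has_weight w f.
Proof.
apply: mem_vspace_of.
  by split=> [x _|n x _]; rewrite /app big1 ?mem0v // => t _;
    rewrite ffunE scaler0.
move=> a u v [altu wu] [altv wv]; split=> [x ux|n x xn]; rewrite app_linear.
  by rewrite altu // altv // scaler0 addr0.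
by rewrite memvD ?memvZ ?wu ?wv.
Qed.

Lemma app2vv (f : multilinear K 2) u : alternating f -> app f [:: u; u] = 0.
Proof. by move=> /(_ [tuple u; u]); apply; rewrite /= inE eqxx. Qed.

Lemma alternating2 (f : multilinear K 2) :
  (forall u, app f [:: u; u] = 0) -> alternating f.
Proof.
move=> f0 [[|u [|v [|]]] //= sx]; rewrite inE andbT negbK => /eqP ->.
exact: f0.
Qed.

Lemma alternating3 (f : multilinear K 3) :
  (forall u v, app f [:: u; u; v] = 0) ->
  (forall u v, app f [:: u; v; u] = 0) ->
  (forall u v, app f [:: v; u; u] = 0) -> alternating f.
Proof.
move=> f12 f13 f23 [[|u [|v [|w [|]]]] //= sx].
rewrite !inE andbT negb_and !negbK => /orP[/orP[]|] /eqP ->; first exact: f12.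
  exact: f13.
exact: f23.
Qed.

Lemma weight1 w (f : multilinear K 1) :
  has_weight w f <->
  (forall m u, u \in gcomp K m -> app f [:: u] \in gcomp K (m + w)).
Proof.
split=> [wf m u um|wf].
  have := wf [tuple m] [tuple u]; rewrite big_ord_recl big_ord0 addr0.
  by apply; case=> [[|]].
case=> [[|m [|]] //= sn] [[|u [|]] //= sx] /(_ ord0) /wf.
by rewrite big_ord_recl big_ord0 addr0.
Qed.

Lemma weight2 w (f : multilinear K 2) :
  has_weight w f <->
  (forall m n u v, u \in gcomp K m -> v \in gcomp K n ->
     app f [:: u; v] \in gcomp K (m + n + w)).
Proof.
split=> [wf m n u v um vn|wf].
  have := wf [tuple m; n] [tuple u; v]; rewrite !big_ord_recl big_ord0 addr0.
  by apply; case=> [[|[|]]].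
case=> [[|m [|n [|]]] //= sn] [[|u [|v [|]]] //= sx] h.
rewrite !big_ord_recl big_ord0 addr0; apply: wf; first exact: (h ord0).
exact: (h (lift ord0 ord0)).
Qed.

Lemma weight3 w (f : multilinear K 3) :
  (forall m n p u v x, u \in gcomp K m -> v \in gcomp K n ->
     x \in gcomp K p -> app f [:: u; v; x] \in gcomp K (m + n + p + w)) ->
  has_weight w f.
Proof.
move=> wf [[|m [|n [|p [|]]]] //= sn] [[|u [|v [|x [|]]]] //= sx] h.
rewrite !big_ord_recl big_ord0 addr0 !addrA; apply: wf; first exact: (h ord0).
  exact: (h (lift ord0 ord0)).
exact: (h (lift ord0 (lift ord0 ord0))).
Qed.

Lemma gcomp_cast m n (u : g) : u \in gcomp K m -> m = n -> u \in gcomp K n.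
Proof. by move=> um <-. Qed.

Lemma diff_cochain1 w (b : multilinear K 1) :
  b \in cochain K 1 w -> diff K 1 b \in cochain K 2 w.
Proof.
move=> /mem_cochain [_ /weight1 wb]; apply/mem_cochain; split.
  apply: alternating2 => u.
  by rewrite app_diff1 !bracketvv // linE subrr subrr.
apply/weight2 => m n u v um vn; rewrite app_diff1.
rewrite !memvB //.
- by apply: gcomp_cast (bracket_gcomp um (wb _ _ vn)) _ => //; ring.
- by apply: gcomp_cast (bracket_gcomp vn (wb _ _ um)) _ => //; ring.
by apply: gcomp_cast (wb _ _ (bracket_gcomp um vn)) _ => //; ring.
Qed.

Lemma diff_cochain2 w (f : multilinear K 2) :
  f \in cochain K 2 w -> diff K 2 f \in cochain K 3 w.
Proof.
move=> /mem_cochain [altf /weight2 wf]; apply/mem_cochain; split.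
  have altC u v := alternatingC u v altf.
  apply: alternating3 => u v; rewrite app_diff2 app2vv // bracketvv // bracket0r !linE.
  - by apply/rowP => l; rewrite !mxE; ring.
  - rewrite (altC v u) (bracketC v u) !linE.
    by apply/rowP => l; rewrite !mxE; ring.
  by apply/rowP => l; rewrite !mxE; ring.
apply: weight3 => m n p u v x um vn xp; rewrite app_diff2.
rewrite !(memvB, memvD) //.
- by apply: gcomp_cast (bracket_gcomp um (wf _ _ _ _ vn xp)) _; ring.
- by apply: gcomp_cast (bracket_gcomp vn (wf _ _ _ _ um xp)) _; ring.
- by apply: gcomp_cast (bracket_gcomp xp (wf _ _ _ _ um vn)) _; ring.
- by apply: gcomp_cast (wf _ _ _ _ (bracket_gcomp um vn) xp) _; ring.
- by apply: gcomp_cast (wf _ _ _ _ (bracket_gcomp um xp) vn) _; ring.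
by apply: gcomp_cast (wf _ _ _ _ (bracket_gcomp vn xp) um) _; ring.
Qed.

Lemma nr_cochain w1 w2 (f h : multilinear K 2) :
  f \in cochain K 2 w1 -> h \in cochain K 2 w2 ->
  nr f h \in cochain K 3 (w1 + w2).
Proof.
move=> /mem_cochain [altf /weight2 wf] /mem_cochain [alth /weight2 wh].
apply/mem_cochain; split.
  have altfC u v := alternatingC u v altf.
  have althC u v := alternatingC u v alth.
  by apply: alternating3 => u v; rewrite app_nr !app2vv // (altfC v u) (althC v u)
    !linE; apply/rowP => l; rewrite !mxE; ring.
apply: weight3 => m n p u v x um vn xp; rewrite app_nr.
rewrite !memvD //;
  [ have := wf _ _ _ _ (wh _ _ _ _ um vn) xp
  | have := wf _ _ _ _ (wh _ _ _ _ vn xp) um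
  | have := wf _ _ _ _ (wh _ _ _ _ xp um) vn
  | have := wh _ _ _ _ (wf _ _ _ _ um vn) xp
  | have := wh _ _ _ _ (wf _ _ _ _ vn xp) um
  | have := wh _ _ _ _ (wf _ _ _ _ xp um) vn ];
  by move=> /gcomp_cast; apply; ring.
Qed.

Lemma nr1_cochain w1 w2 (f : multilinear K 2) (b : multilinear K 1) :
  f \in cochain K 2 w1 -> b \in cochain K 1 w2 ->
  nr1 f b \in cochain K 2 (w1 + w2).
Proof.
move=> /mem_cochain [altf /weight2 wf] /mem_cochain [_ /weight1 wb].
apply/mem_cochain; split.
  apply: alternating2 => u.
  rewrite app_nr1 (alternatingC u) // app2vv // linE subr0.
  by rewrite subrr.
apply/weight2 => m n u v um vn; rewrite app_nr1 memvB ?memvD //;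
  [ have := wf _ _ _ _ (wb _ _ um) vn
  | have := wf _ _ _ _ um (wb _ _ vn)
  | have := wb _ _ (wf _ _ _ _ um vn) ];
  by move=> /gcomp_cast; apply; ring.
Qed.

End Cochains.

(** * Elementary cochains and a spanning set of C^q_w *)

Fixpoint subseqs (q : nat) (r : seq nat) : seq (seq nat) :=
  match r, q with
  | _, 0 => [:: [::]]
  | [::], _ => [::]
  | a :: r', q'.+1 => [seq a :: s | s <- subseqs q' r'] ++ subseqs q r'
  end%N.

Lemma mem_subseqs q r s : (s \in subseqs q r) = (size s == q) && subseq s r.
Proof.
elim: r q s => [|a r IH] [|q] s.
- by rewrite inE; case: s.
- by case: s => [|x s] //=; rewrite andbF.
- by rewrite inE; case: s.
rewrite mem_cat IH; case: s => [|x s] /=.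
  by rewrite orbF; apply/negbTE/mapP => -[].
have [-> | xa] := eqVneq x a.
  rewrite mem_map ?IH; last by move=> ? ? [].
  rewrite eqSS; case: eqP => //= _; apply/orb_idr.
  by apply: subseq_trans; apply: subseq_cons.
rewrite -[RHS]orFb; congr (_ || _); apply/negbTE/mapP => -[y _ [xE]].
by rewrite xE eqxx in xa.
Qed.

Arguments subseqs : simpl never.

(** Labels (s, l) of the elementary cochains of weight w: s is an increasing q-tuple of basis
    indices, l an output index, and the degrees satisfy deg s + w = deg l. *)
Definition fbasis (q : nat) (w : int) : seq (seq nat * nat) :=
  [seq p <- [seq (s, l) | s <- subseqs q (iota 0 14), l <- iota 0 14]
   | (sumn [seq fdeg i | i <- p.1])%:Z + w == fdeg p.2].

Lemma subseq_iota14 s :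
  subseq s (iota 0 14) = sorted ltn s && all (fun i => i < 14)%N s.
Proof.
apply/idP/andP => [ss | [srt s14]].
  split; first exact: (subseq_sorted ltn_trans ss (iota_ltn_sorted 0 14)).
  by apply/allP => i /(mem_subseq ss); rewrite mem_iota.
have <- : [seq i <- iota 0 14 | i \in s] = s; last exact: filter_subseq.
apply: (irr_sorted_eq ltn_trans ltnn _ srt).
  exact/(sorted_filter ltn_trans)/iota_ltn_sorted.
move=> i; rewrite mem_filter mem_iota /= andbC; apply: andb_idl.
by move/(allP s14).
Qed.

Lemma fbasisP q w s l : reflect
  [/\ size s = q, sorted ltn s, all (fun i => i < 14)%N s, (l < 14)%N
    & (sumn [seq fdeg i | i <- s])%:Z + w = fdeg l]
  ((s, l) \in fbasis q w).
Proof.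
rewrite mem_filter; apply: (iffP andP) => [[/eqP wE /allpairsP]|].
  case=> -[s' l'] [ss ll [es el]]; move: ss ll wE; rewrite -es -el.
  by rewrite mem_subseqs subseq_iota14 mem_iota => /and3P[/eqP -> -> ->].
case=> ss srt s14 l14 ->; split=> //.
by apply: allpairs_f; rewrite ?mem_subseqs ?mem_iota // ss eqxx subseq_iota14 srt.
Qed.

Section Elementary.
Variable K : fieldType.
Hypothesis charK : [pchar K] =i pred0.
Local Notation g := 'rV[K]_14.

(* The q-form taking (v_1, ..., v_q) to the determinant of the s-coordinates of
   the v_i, times the l-th basis vector. *)
Definition elem (q : nat) (s : seq nat) (l : nat) : multilinear K q :=
  [ffun t : q.-tuple 'I_14 =>
     \det (\matrix_(i < q, j < q) (val (tnth t i) == nth 0%N s j)%:R)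
       *: bvec K l].

Lemma app_elem q (s : q.-tuple 'I_14) l (x : seq g) :
  app (elem q [seq val i | i <- s] l) x =
    \det (\matrix_(i < q, j < q) x`_i 0 (tnth s j)) *: bvec K l.
Proof.
(* Leibniz expansion of the stored 0/1 determinant: each permutation selects exactly one tuple t,
   namely s permuted. *)
rewrite /app (eq_bigr (fun t : q.-tuple 'I_14 => (\sum_(sg : 'S_q)
   (-1) ^+ sg * ((t == [tuple tnth s (sg i) | i < q])%:R *
   \prod_(i < q) x`_i 0 (tnth t i))) *: bvec K l)) => [|t _].
  rewrite -scaler_suml exchange_big; congr (_ *: _); apply: eq_bigr => sg _ /=.
  rewrite -mulr_sumr (bigD1 [tuple tnth s (sg i) | i < q]) //=.
  rewrite [X in _ + X]big1 ?addr0 => [|t /negPf ->]; last by rewrite mul0r.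
  rewrite eqxx mul1r; congr (_ * _); apply: eq_bigr => i _.
  by rewrite mxE tnth_mktuple.
rewrite ffunE scalerA mulr_sumr; congr (_ *: _).
apply: eq_bigr => sg _; rewrite mulrCA; congr (_ * _); rewrite mulrC.
congr (_ * _); have [->|ts] := eqVneq.
  rewrite big1 // => i _.
  by rewrite mxE tnth_mktuple (nth_map (tnth s i)) ?size_tuple // -tnth_nth eqxx.
have [i tsi] : exists i, tnth t i != tnth s (sg i).
  apply/existsP; apply: contraNT ts; rewrite negb_exists => /forallP ts.
  apply/eqP/eq_from_tnth => i; rewrite tnth_mktuple; apply/eqP.
  by have := ts i; rewrite negbK.
rewrite (bigD1 i) //= mxE (nth_map (tnth s i)) ?size_tuple // -tnth_nth.
by rewrite (inj_eq val_inj) (negPf tsi) mul0r.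
Qed.

Lemma fbasis_tuple q w s l : (s, l) \in fbasis q w ->
  exists (s' : q.-tuple 'I_14) (l' : 'I_14),
    s = [seq val i | i <- s'] /\ l = val l'.
Proof.
case/fbasisP => ss _ s14 l14 _.
have sz : size [seq inord i : 'I_14 | i <- s] == q by rewrite size_map ss.
exists (Tuple sz), (Ordinal l14); split=> //=.
rewrite -map_comp -[LHS]map_id; apply/eq_in_map => i /(allP s14) i14 /=.
by rewrite inordK.
Qed.

Lemma elem_cochain q w s l :
  (s, l) \in fbasis q w -> elem q s l \in cochain K q w.
Proof.
move=> sl; have [s' [l' [sE lE]]] := fbasis_tuple sl.
case/fbasisP: sl => _ _ _ _; rewrite sE lE => wE; apply/mem_cochain; split.
  move=> x /(uniqPn 0) [i [j [ij jx eq_ij]]]; rewrite app_elem.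
  rewrite size_tuple in jx; have ix := ltn_trans ij jx.
  rewrite (@determinant_alternate _ _ _ (Ordinal ix) (Ordinal jx)) ?scale0r //.
    by rewrite -val_eqE /= ltn_eqF.
  by move=> k; rewrite !mxE /= eq_ij.
move=> n x xn; rewrite app_elem.
set A := (X in \det X); have [->|det0] := eqVneq (\det A) 0.
  by rewrite scale0r mem0v.
(* A nonzero determinant has a nonzero Leibniz term; its permutation matches the degrees of the
   arguments with those of s, so the sums of degrees agree. *)
have [sg /forallP sgP] :
    exists sg : 'S_q, [forall i : 'I_q, x`_i 0 (tnth s' (sg i)) != 0].
  apply/existsP; apply: contraNT det0 => /existsPn nosg; apply/eqP.
  rewrite /determinant big1 // => sg _; have /forallPn [i] := nosg sg.
  by rewrite negbK => /eqP xi0; rewrite (bigD1 i) //= mxE xi0 mul0r mulr0.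
have nE (i : 'I_q) : tnth n i = bdeg (tnth s' (sg i)).
  by have := xn i; rewrite (tnth_nth (0 : g)) => /mem_gcomp/(_ _ (sgP i)).
rewrite memvZ // (eq_bigr (fun i => (bdeg (tnth s' (sg i)))%:Z)) => [|i _]; last exact: nE.
apply: gcomp_cast (bvec_gcomp K l') _.
rewrite -[(bdeg l')%:Z]/((fdeg l')%:Z) -wE; congr (_ + _).
transitivity (\sum_(i < q) (bdeg (tnth s' i))%:Z); last first.
  by rewrite [LHS](reindex_inj (perm_inj (s := sg))).
rewrite -map_comp sumnE big_map big_tuple -natz natr_sum; apply: eq_bigr => i _.
by rewrite natz.
Qed.

(** On increasing tuples an elementary cochain is a delta function: an increasing t different from s
    has an entry outside s, and its row in the determinant is zero. *)
Lemma elem_sorted q (s t : q.-tuple 'I_14) l :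
  sorted ltn [seq val i | i <- s] -> sorted ltn [seq val i | i <- t] ->
  (elem q [seq val i | i <- s] l : {ffun _ -> g}) t =
    (t == s)%:R *: bvec K l.
Proof.
move=> srt_s srt_t; rewrite ffunE; congr (_ *: _); have [->|ts] := eqVneq t s.
  rewrite -[RHS](det1 K q); congr (\det _); apply/matrixP => i j; rewrite !mxE.
  rewrite (nth_map (tnth s i)) ?size_tuple // -tnth_nth (inj_eq val_inj).
  rewrite (inj_eq (tuple_uniqP _ _)) //.
  by rewrite -(map_inj_uniq val_inj) (sorted_uniq ltn_trans ltnn).
have uniqP (r : q.-tuple 'I_14) : sorted ltn [seq val i | i <- r] -> uniq r.
  by rewrite -(map_inj_uniq val_inj); apply: sorted_uniq ltn_trans ltnn _.
have [i ti] : exists i, tnth t i \notin s.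
  apply/existsP; apply: contraNT ts; rewrite negb_exists => /forallP ts.
  have sub : {subset t <= s} by move=> x /tnthP [i ->]; have := ts i; rewrite negbK.
  have [|_ eq_ts] := uniq_min_size (uniqP _ srt_t) sub; first by rewrite !size_tuple.
  apply/eqP/val_inj/(inj_map val_inj) => /=.
  apply: (irr_sorted_eq ltn_trans ltnn) => // k.
  by apply/mapP/mapP => -[x xs ->]; exists x; rewrite // ?eq_ts // -eq_ts.
rewrite (expand_det_row _ i) big1 // => j _; rewrite !mxE.
rewrite (nth_map (tnth s j)) ?size_tuple // -tnth_nth (inj_eq val_inj).
have [tE|_] := eqVneq (tnth t i) (tnth s j); last by rewrite mul0r.
by rewrite tE mem_tnth in ti.
Qed.

Lemma app_swap q (f : multilinear K q) s1 u v s2 : alternating f ->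
  size (s1 ++ u :: v :: s2) = q ->
  app f (s1 ++ u :: v :: s2) = - app f (s1 ++ v :: u :: s2).
Proof.
move=> altf sq.
have f0 w : app f (s1 ++ w :: w :: s2) = 0.
  have sz : size (s1 ++ w :: w :: s2) == q by rewrite -sq !size_cat.
  apply: (altf (Tuple sz)) => /=.
  by rewrite cat_uniq /= inE eqxx !andbF.
have l1 : (size s1 < q)%N by rewrite -sq size_cat /=; lia.
have l2 w : (size (rcons s1 w) < q)%N by rewrite -sq size_cat size_rcons /=; lia.
have lin2 w : app f (s1 ++ w :: (u + v) :: s2) =
    app f (s1 ++ w :: u :: s2) + app f (s1 ++ w :: v :: s2).
  by rewrite -!(cat_rcons w) (app_slotE f s2 (l2 w)).
have := f0 (u + v); rewrite (app_slotE f _ l1) !lin2 !f0 add0r addr0 => /eqP.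
by rewrite addr_eq0 => /eqP.
Qed.

(** Only vanishing is transported along a permutation, so no sign has to be tracked. *)
Lemma app_perm0 q (f : multilinear K q) (t t' : seq g) : alternating f ->
  size t = q -> perm_eq t t' -> app f t = 0 -> app f t' = 0.
Proof.
move=> altf.
have move_right s1 x s2 s3 : size (s1 ++ x :: s2 ++ s3) = q ->
    app f (s1 ++ x :: s2 ++ s3) = 0 -> app f (s1 ++ s2 ++ x :: s3) = 0.
  elim: s2 s1 => [|y s2 IH] s1 //= sq; rewrite app_swap // => /eqP.
  rewrite oppr_eq0 => /eqP; rewrite -!(cat_rcons y); apply: IH.
  by rewrite -sq !size_cat size_rcons /= !size_cat; lia.
suff gen p : size (p ++ t) = q -> perm_eq t t' ->
    app f (p ++ t) = 0 -> app f (p ++ t') = 0 by exact: (gen [::]).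
elim: t t' p => [|x t IH] t' p; first by rewrite perm_sym => _ /perm_nilP ->.
move=> sq tt'; have xt' : x \in t' by rewrite -(perm_mem tt') mem_head.
case/splitPr: xt' tt' => a b; rewrite perm_sym -[x :: b]cat1s.
rewrite perm_catCA perm_cons.
rewrite perm_sym => tab ft0; apply: move_right.
  by rewrite -sq !size_cat /= (perm_size tab) size_cat.
rewrite -cat_rcons; apply: (IH _ (rcons p x)) => //; rewrite ?cat_rcons //.
Qed.

Lemma alternating_eq0 q (f : multilinear K q) : alternating f ->
  (forall t : q.-tuple 'I_14, sorted ltn [seq val i | i <- t] ->
     (f : {ffun _ -> g}) t = 0) -> f = 0.
Proof.
move=> altf f0; apply/ffunP => t; rewrite ffunE -app_basis.
have [ut|nut] := boolP (uniq [seq bvec K (val i) | i <- t]); last first.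
  exact: (altf [tuple of [seq bvec K (val i) | i <- t]] nut).
have sz : size (sort (fun i j : 'I_14 => i <= j)%N t) == q.
  by rewrite size_sort size_tuple.
have {}f0 := f0 (Tuple sz); rewrite -app_basis /= in f0.
apply: app_perm0 (f0 _) => //.
- by rewrite size_map size_sort size_tuple.
- by rewrite perm_map // perm_sort.
rewrite ltn_sorted_uniq_leq map_inj_uniq; last exact: val_inj.
rewrite sort_uniq (map_uniq ut) /= sorted_map.
by apply: sort_sorted => i j; apply: leq_total.
Qed.

Lemma cochain_span q w : (cochain K q w <=
  <<[seq elem q p.1 p.2 | p <- fbasis q w]>>)%VS.
Proof.
apply/subvP => f fC; have [altf wf] := (mem_cochain w f).1 fC.
pose S (s : q.-tuple 'I_14) := sorted ltn [seq val i | i <- s].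
pose W (s : q.-tuple 'I_14) (l : 'I_14) :=
  (sumn [seq fdeg i | i <- [seq val i | i <- s]])%:Z + w == fdeg l.
pose h := \sum_(s : q.-tuple 'I_14 | S s) \sum_(l < 14 | W s l)
  (f : {ffun _ -> g}) s 0 l *: elem q [seq val i | i <- s] l.
have memB s l : S s -> W s l ->
    ([seq val i | i <- s], val l) \in fbasis q w.
  move=> Ss /eqP Wsl; apply/fbasisP; split=> //.
  - by rewrite size_map size_tuple.
  - by apply/allP => _ /mapP [i _ ->]; apply: ltn_ord.
  exact: ltn_ord.
have hC : h \in cochain K q w.
  apply: memv_suml => s Ss; apply: memv_suml => l Wsl.
  by apply: memvZ; apply/elem_cochain/memB.
suff -> : f = h.
  apply: memv_suml => s Ss; apply: memv_suml => l Wsl; apply/memvZ/memv_span.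
  by apply/mapP; exists ([seq val i | i <- s], val l); rewrite ?memB.
apply/eqP; rewrite -subr_eq0; apply/eqP/alternating_eq0.
  by have /mem_cochain [] : f - h \in cochain K q w by rewrite rpredB.
move=> t St; have -> : (f - h : {ffun _ -> g}) t = (f : {ffun _ -> g}) t -
    \sum_(l < 14 | W t l) (f : {ffun _ -> g}) t 0 l *: bvec K l.
  rewrite 2!ffunE /h sum_ffunE (bigD1 t) //=.
  rewrite [X in _ - (_ + X)]big1 ?addr0 => [|s /andP [Ss st]].
    congr (_ - _); rewrite sum_ffunE; apply: eq_bigr => l _.
    by rewrite ffunE elem_sorted // eqxx scale1r.
  rewrite sum_ffunE big1 // => l _.
  by rewrite ffunE elem_sorted // eq_sym (negPf st) scale0r scaler0.
(* What remains of f - h at t are the coordinates of f at t in the wrong degree, and these vanish by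
   the weight condition. *)
rewrite [X in X - _]vec_bvec (bigID (W t)) /= addrAC subrr add0r big1 // => l Wl.
have [->|tl] := eqVneq ((f : {ffun _ -> g}) t 0 l) 0; first by rewrite scale0r.
have tw i : tnth [tuple of [seq bvec K (val i) | i <- t]] i \in
    gcomp K (tnth [tuple of [seq (bdeg i)%:Z | i <- t]] i).
  by rewrite !tnth_map bvec_gcomp.
have := wf _ _ tw; rewrite app_basis => /mem_gcomp/(_ l tl) wl.
case/negP: Wl; rewrite /W -[(fdeg l)%:Z]/((bdeg l)%:Z) wl.
rewrite -map_comp sumnE big_map big_tuple -natz natr_sum; apply/eqP.
by congr (_ + w); apply: eq_bigr => i _; rewrite tnth_map natz.
Qed.

End Elementary.

(** * Integer model of the complex, and fraction-free elimination *)

(** An index m >= 14 stands for the zero vector, as [bvec K m] is then 0. *)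
Definition fapp (z : seq nat -> fsum) (m : nat) (r : seq nat) : fsum :=
  if (m < 14)%N then z (m :: r) else [::].

(* The terms of the Chevalley-Eilenberg differential at basis vectors t: the
   term (c, r, Some i) contributes c [e_i, z r] and (c, r, None) contributes
   c (z r). *)
Definition fterms (q : nat) (t : seq nat) : seq (Z * seq nat * option nat) :=
  [seq ((-1) ^+ i : Z, del i t, Some (nth 0%N t i)) | i <- iota 0 q.+1] ++
  flatten [seq flatten [seq
      [seq (Z.mul ((-1) ^+ (i + j)) p.1, p.2 :: del i (del j t), None)
      | p <- fbr (nth 0%N t i) (nth 0%N t j)] | i <- iota 0 j]
    | j <- iota 0 q.+1].

Definition feval (z : seq nat -> fsum) (T : seq (Z * seq nat * option nat)) :
    fsum :=
  flatten [seq fscale p.1.1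
    (if p.2 is Some i then fbind (z p.1.2) (fbr i) else z p.1.2) | p <- T].

Definition fcirc (y z : seq nat -> fsum) (t : seq nat) : fsum :=
  let a := nth 0%N t 0 in let b := nth 0%N t 1 in let c := nth 0%N t 2 in
  fbind (z [:: a; b]) (fun m => fapp y m [:: c]) ++
  (fbind (z [:: b; c]) (fun m => fapp y m [:: a]) ++
   fbind (z [:: c; a]) (fun m => fapp y m [:: b])).

Definition fnr (y z : seq nat -> fsum) (t : seq nat) : fsum :=
  fcirc y z t ++ fcirc z y t.

(* [a] removed from [s], with the parity of its position. *)
Fixpoint extract (a : nat) (s : seq nat) : option (bool * seq nat) :=
  if s is x :: s' then
    if eqn x a then Some (false, s')
    else if extract a s' is Some (b, r) then Some (~~ b, x :: r) else None
  else None.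

(* Laplace expansion along the first row of the determinant in [elem]. *)
Fixpoint wedge (s t : seq nat) : Z :=
  if t is a :: t' then
    if extract a s is Some (b, r) then
      if b then Z.opp (wedge r t') else wedge r t'
    else Z0
  else 1.

Definition felem (s : seq nat) (l : nat) (t : seq nat) : fsum :=
  let c := wedge s t in if c is Z0 then [::] else [:: (c, l)].

(* A sparse 2-cochain: the list of its nonzero values c e_l on basis pairs. *)
Notation entries := (seq (seq nat * nat * Z)).

Definition fents (e : entries) (t : seq nat) : fsum :=
  flatten [seq fscale p.2 (felem p.1.1 p.1.2 t) | p <- e].

(* Tabulation, so that evaluations of an expensive cochain are shared. *)
Definition ftab (z : seq nat -> fsum) : seq (seq fsum) :=
  mkseq (fun i => mkseq (fun j => z [:: i; j]) 14) 14.

Definition flook (T : seq (seq fsum)) (t : seq nat) : fsum :=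
  nth [::] (nth [::] T (nth 0%N t 0)) (nth 0%N t 1).

(* [fbasis] grouped by tuples. *)
Definition fgroups (q : nat) (w : int) : seq (seq nat * seq nat) :=
  [seq p <- [seq (s, let d := (sumn [seq fdeg i | i <- s])%:Z + w in
                     [seq l <- iota 0 14 | d == fdeg l])
            | s <- subseqs q (iota 0 14)] | p.2 != [::]].

Definition fcoords (X : Type) (G : seq (X * seq nat)) (ev : X -> fsum) : seq Z :=
  flatten [seq let v := ev p.1 in [seq fcoef l v | l <- p.2] | p <- G].

(** The terms of the differential depend only on the tuple, so they are expanded once and shared by
    all cochains evaluated. *)
Definition fdgroups (q : nat) (w : int) :=
  [seq (fterms q p.1, p.2) | p <- fgroups q.+1 w].

Fixpoint zcomb (a : Z) (r : seq Z) (b : Z) (s : seq Z) : seq Z :=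
  match r, s with
  | x :: r', y :: s' => Z.add (Z.mul a x) (Z.opp (Z.mul b y)) :: zcomb a r' b s'
  | [::], _ => [seq Z.opp (Z.mul b y) | y <- s]
  | _, [::] => [seq Z.mul a x | x <- r]
  end.

Definition zhead (r : seq Z) : Z := if r is x :: _ then x else Z0.

Definition znull (x : Z) : bool := if x is Z0 then true else false.

(** The combination (a/d) r - (b/d) r0 with d = gcd(b, a) has leading entry zero, and that entry is
    dropped. Dividing by d slows the growth of entries. *)
Definition zelim (r0 r : seq Z) : seq Z :=
  let a := zhead r0 in let b := zhead r in
  if znull b then behead r
  else let d := Z.gcd b a in zcomb (Z.div a d) (behead r) (Z.div b d) (behead r0).

Fixpoint zpivot (rows : seq (seq Z)) : option (seq Z) :=
  if rows is r :: rows' then if znull (zhead r) then zpivot rows' else Some r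
  else None.

(* A lower bound for the rank of the first n columns, by fraction-free
   elimination. *)
Fixpoint zrank (n : nat) (rows : seq (seq Z)) : nat :=
  if n is n'.+1 then
    match zpivot rows with
    | None => zrank n' [seq behead r | r <- rows]
    | Some r0 =>
      (zrank n' [seq r <- [seq zelim r0 r | r <- rows] | ~~ all znull r]).+1
    end
  else 0%N.

(** * Soundness of the integer model over K *)

Section Model.
Variable K : fieldType.
Hypothesis charK : [pchar K] =i pred0.
Local Notation g := 'rV[K]_14.

Lemma nth_zcomb a r b s j :
  zK K (nth 0 (zcomb a r b s) j) =
    zK K a * zK K (nth 0 r j) - zK K b * zK K (nth 0 s j).
Proof.
elim: r s j => [|x r IH] [|y s] [|j] //=;
  rewrite ?zKD ?zKN ?zKM ?zK0 ?mulr0 ?sub0r ?subr0 ?oppr0 //.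
- have [js|sj] := ltnP j (size s); first by rewrite (nth_map 0) // zKN zKM.
  by rewrite !nth_default ?size_map // mulr0 oppr0.
have [jr|rj] := ltnP j (size r); first by rewrite (nth_map 0) // zKM.
by rewrite !nth_default ?size_map // mulr0.
Qed.

Lemma zpivotP rows : 
  if zpivot rows is Some r0 then r0 \in rows /\ zhead r0 != 0 else true.
Proof.
elim: rows => [//|r rows IH] /=; case rE: (zhead r) => [|p|p] /=.
- by case: zpivot IH => // r0 [r0R]; rewrite inE r0R orbT.
- by rewrite mem_head rE.
by rewrite mem_head rE.
Qed.

(** Induction on the columns. A row with nonzero leading entry shows that the first functional is
    not zero on U, so its kernel in U has smaller dimension; the eliminated rows are realised by
    vectors of that kernel. Without a pivot the column is skipped. *)
Lemma zrank_le (V : vectType K) (n : nat) (phi : nat -> V -> K) (U : {vspace V})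
    (rows : seq (seq Z)) :
  (forall j a u v, phi j (a *: u + v) = a * phi j u + phi j v) ->
  (forall r, r \in rows -> exists2 v, v \in U &
     forall j, (j < n)%N -> phi j v = zK K (nth 0 r j)) ->
  (zrank n rows <= \dim U)%N.
Proof.
elim: n phi U rows => [//|n IH] phi U rows lin rep /=.
have := zpivotP rows; case: zpivot => [r0 [r0R a0]|_]; last first.
  apply: (IH (fun j => phi j.+1)) => [j a u v|r /mapP [r' r'R ->]].
    exact: lin.
  have [v vU vr] := rep _ r'R; exists v => // j jn; rewrite vr //.
  by rewrite nth_behead.
have [v0 v0U v0r] := rep _ r0R.
pose phi0 : 'Hom(V, K^o) := linfun (phi 0%N : V -> K^o).
have phi0E v : phi0 v = phi 0%N v by apply: linfunE => a u w; apply: lin.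
pose U' := (U :&: lker phi0)%VS.
have headE r v : (forall j, (j < n.+1)%N -> phi j v = zK K (nth 0 r j)) ->
    phi 0%N v = zK K (zhead r) by move=> /(_ 0%N isT); case: (r).
have lt_U' : (\dim U' < \dim U)%N.
  rewrite ltn_neqAle dimvS ?capvSl // andbT.
  apply: contraNneq a0 => dimE; rewrite -(zK_eq0 charK) -(headE _ _ v0r) -phi0E.
  have : v0 \in U' by have /eqP -> : U' == U by rewrite eqEdim capvSl dimE /=.
  by rewrite memv_cap memv_ker => /andP [].
apply: leq_trans lt_U'; rewrite ltnS.
apply: (IH (fun j => phi j.+1)) => [j a u v|r]; first exact: lin.
rewrite mem_filter => /andP [_ /mapP [r' r'R ->]] {r}.
have [v vU vr] := rep _ r'R; rewrite /zelim.
case: ifP => [/negPn b0|_].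
  exists v => [|j jn]; last by rewrite vr // nth_behead.
  rewrite memv_cap vU memv_ker phi0E (headE _ _ vr).
  by case: (zhead r') b0 => //= _; rewrite zK0 eqxx.
set d := Z.gcd _ _; pose x := zK K (Z.div (zhead r0) d).
(* The vector x v - y v0 mirrors [zelim]; the first functional kills it because (a/d) b = (b/d)
   a. *)
pose y := zK K (Z.div (zhead r') d).
have phiE j : phi j (x *: v + - y *: v0) = x * phi j v - y * phi j v0.
  have phi00 k : phi k 0 = 0.
    by have := lin k (-1) 0 0; rewrite scaler0 addr0 mulN1r addNr.
  by rewrite lin -[- y *: v0]addr0 lin phi00 addr0 mulNr.
exists (x *: v + - y *: v0) => [|j jn]; last first.
  by rewrite phiE vr // v0r // nth_zcomb !nth_behead.
rewrite memv_cap memvD ?memvZ //= memv_ker phi0E phiE (headE _ _ vr).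
rewrite (headE _ _ v0r) -!zKM subr_eq0; apply/eqP; congr (zK K _).
by rewrite [RHS]Z.gcd_div_swap Z.mul_comm.
Qed.

(** The bridge from computation to K: [z] gives integral values on index lists, and nothing forces
    the result to be alternating. *)
Definition real (q : nat) (z : seq nat -> fsum) : multilinear K q :=
  [ffun t : q.-tuple 'I_14 => vec K (z [seq val i | i <- t])].

Lemma app_real q z (r : seq nat) : size r = q -> all (fun i => i < 14)%N r ->
  app (real q z) [seq bvec K i | i <- r] = vec K (z r).
Proof.
move=> sr r14.
have sz : size [seq inord i : 'I_14 | i <- r] == q by rewrite size_map sr.
have valE : [seq val i | i <- Tuple sz] = r.
  rewrite /= -map_comp -[RHS]map_id; apply/eq_in_map => i /(allP r14) i14 /=.
  by rewrite inordK.
have := app_basis (real q z) (Tuple sz); rewrite ffunE valE => <-.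
by rewrite -[in LHS]valE -map_comp.
Qed.

Lemma app_real_vec q z (s : fsum) (r : seq nat) : (size r).+1 = q ->
  all (fun i => i < 14)%N r ->
  app (real q z) (vec K s :: [seq bvec K i | i <- r]) =
    vec K (fbind s (fun m => fapp z m r)).
Proof.
move=> sr r14; have q0 : (0 < q)%N by rewrite -sr.
have lin := app_slotE (real q z) (s1 := [::]) [seq bvec K i | i <- r] q0.
elim: s => [|[c m] s IH]; first by rewrite !vec_nil lin.
rewrite -[fbind _ _]/(fscale c (fapp z m r) ++ fbind s _) vec_cat vec_scale -IH.
rewrite {1}/vec big_cons lin lin -/(vec K s) /= /fapp; congr (_ *: _ + _).
case: ltnP => m14.
  by rewrite -(app_real (q := q) z (r := m :: r)) /= ?m14.
have -> : bvec K m = 0.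
  by apply/rowP => l; rewrite bvecE mxE ltn_eqF // (leq_trans (ltn_ord l)).
by rewrite lin vec_nil.
Qed.

Lemma bracket_bvec_vec (i : nat) s : (i < 14)%N ->
  bracket (bvec K i) (vec K s) = vec K (fbind s (fbr i)).
Proof.
move=> i14; rewrite vec_bind {1}/vec linear_sum; apply: eq_bigr => -[c m] _ /=.
rewrite bracketZr; congr (_ *: _); have [m14|m14] := ltnP m 14.
  exact: (bracket_bvec K (Ordinal i14) (Ordinal m14)).
have -> : bvec K m = 0.
  by apply/rowP => l; rewrite bvecE mxE ltn_eqF // (leq_trans (ltn_ord l)).
rewrite bracket0r; suff -> : fbr i m = [::] by rewrite vec_nil.
have m12 : (12 <= m)%N := leq_trans (isT : (12 <= 14)%N) m14.
case: i {i14} => [|[|i]] /=; first by rewrite /fadX nth_default.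
  by rewrite /fadY nth_default.
by case: m m14 {m12} => [|[|m]].
Qed.

Lemma all_del (T : Type) (p : pred T) i s : all p s -> all p (del i s).
Proof.
move=> ps; rewrite /del all_cat; apply/andP; split.
  by move: ps; rewrite -{1}(cat_take_drop i s) all_cat => /andP [].
by move: ps; rewrite -{1}(cat_take_drop i.+1 s) all_cat => /andP [].
Qed.

Lemma size_del (T : Type) i (s : seq T) : (i < size s)%N ->
  size (del i s) = (size s).-1.
Proof. by move=> lt_i; rewrite /del size_cat size_take size_drop lt_i; lia. Qed.

Lemma map_del (S T : Type) (f : S -> T) i s : [seq f x | x <- del i s] = del i (map f s).
Proof. by rewrite /del map_cat map_take map_drop. Qed.

Lemma vec_flatten (I : Type) (s : seq I) F :
  vec K (flatten [seq F i | i <- s]) = \sum_(i <- s) vec K (F i).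
Proof. 
by elim: s => [|i s IH]; rewrite ?big_nil ?vec_nil // big_cons /= vec_cat IH.
Qed.

Lemma zK_sign n : zK K ((-1) ^+ n) = (-1) ^+ n.
Proof. by elim: n => [|n IH]; rewrite ?expr0 ?zK1 // !exprS zKM IH. Qed.

Lemma real_diff q z :
  diff K q (real q z) = real q.+1 (fun t => feval z (fterms q t)).
Proof.
apply/ffunP => t; rewrite diffE !ffunE; set r := [seq val i | i <- t].
have rE : [seq bvec K (val i) | i <- t] = [seq bvec K i | i <- r].
  by rewrite -map_comp.
have sr : size r = q.+1 by rewrite size_map size_tuple.
have r14 : all (fun i => i < 14)%N r.
  by apply/allP => _ /mapP [i _ ->]; apply: ltn_ord.
have nthr i : (i < q.+1)%N -> [seq bvec K i | i <- r]`_i = bvec K (nth 0%N r i).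
  by move=> iq; rewrite (nth_map 0%N) // sr.
have nth14 i : (nth 0%N r i < 14)%N.
  have [lt_i|] := ltnP i (size r); first exact: (allP r14 _ (mem_nth _ lt_i)).
  by move=> ?; rewrite nth_default.
rewrite rE /diff_fun vec_flatten big_cat big_map; congr (_ + _).
  rewrite -[iota 0 q.+1]/(index_iota 0 q.+1) big_mkord; apply: eq_bigr => i _.
  rewrite vec_scale zK_sign nthr // -(map_del (bvec K)) app_real ?all_del //.
    by rewrite bracket_bvec_vec.
  by rewrite size_del sr.
rewrite big_flatten big_map -[iota 0 q.+1]/(index_iota 0 q.+1) big_mkord.
apply: eq_bigr => j _; rewrite big_flatten big_map.
rewrite -[X in iota 0 X]subn0 -/(index_iota 0 j) big_mkord.
apply: eq_bigr => i _; have iq : (i < q.+1)%N := ltn_trans (ltn_ord i) (ltn_ord j).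
rewrite !nthr // (bracket_bvec K (Ordinal (nth14 i)) (Ordinal (nth14 j))).
rewrite -!(map_del (bvec K)) app_real_vec ?all_del // ?size_del ?sr //=; last first.
- by have := ltn_ord i; have := ltn_ord j; lia.
- by have := ltn_ord i; have := ltn_ord j; lia.
rewrite vec_bind scaler_sumr big_map; apply: eq_big_seq => p pbr /=.
rewrite vec_scale zKM zK_sign scalerA /fapp.
by rewrite (allP (fbr_lt14 (Ordinal (nth14 i)) (Ordinal (nth14 j))) _ pbr).
Qed.

Lemma real_nr y z : nr (real 2 y) (real 2 z) = real 3 (fnr y z).
Proof.
have fcircE y1 z1 : circ (real 2 y1) (real 2 z1) = real 3 (fcirc y1 z1).
  apply/ffunP => t; rewrite !ffunE.
  case: t => [[|a [|b [|c [|]]]] //= _]; rewrite /circ_fun /fcirc /= !vec_cat.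
  have app2 (i j : 'I_14) : app (real 2 z1) [:: bvec K i; bvec K j] =
      vec K (z1 [:: val i; val j]).
    by rewrite -(app_real (q := 2) z1 (r := [:: val i; val j])) //= !ltn_ord.
  rewrite !app2 addrA.
  have app2v (s : fsum) (i : 'I_14) : app (real 2 y1) [:: vec K s; bvec K i] =
      vec K (fbind s (fun m => fapp y1 m [:: val i])).
    by rewrite -(app_real_vec (q := 2) y1 s (r := [:: val i])) //= ltn_ord.
  by rewrite !app2v.
rewrite /nr !fcircE; apply/ffunP => t.
by rewrite !ffunE -vec_cat.
Qed.

Lemma nth_del (s : seq nat) k j : (k < size s)%N ->
  nth 0%N (del k s) j = nth 0%N s (bump k j).
Proof.
move=> ks; rewrite /del nth_cat size_take ks nth_drop /bump.
case: ltnP => [jk|kj]; first by rewrite nth_take // leqNgt jk.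
by congr nth; lia.
Qed.

Lemma extractE (a : nat) s : extract a s =
  if a \in s then Some (odd (index a s), rem a s) else None.
Proof.
elim: s => [//|x s IH] /=; rewrite inE eqnE IH [a == x]eq_sym.
by case: eqVneq => //= _; case: ifP.
Qed.

Lemma wedgeE q (s t : seq nat) : uniq s -> size s = q -> size t = q ->
  zK K (wedge s t) =
    \det (\matrix_(i < q, j < q) (nth 0%N t i == nth 0%N s j)%:R).
Proof.
elim: q s t => [|q IH] s [|a t] //= us ss; first by rewrite det_mx00 zK1.
move=> [st]; rewrite (expand_det_row _ ord0) extractE.
case: ifPn => [as_|as_]; last first.
  rewrite zK0 big1 // => j _; rewrite mxE /=; case: eqP => [aE|_]; rewrite ?mul0r //.
  by rewrite aE mem_nth ?ss in as_.
have kq : (index a s < q.+1)%N by rewrite -ss index_mem.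
rewrite (bigD1 (Ordinal kq)) //= big1 ?addr0 => [|j jk]; last first.
  rewrite mxE /=; case: eqP => [aE|_]; rewrite ?mul0r //.
  by move: jk; rewrite -val_eqE /= aE index_uniq ?ss ?eqxx.
rewrite mxE /= nth_index // eqxx mul1r /cofactor add0n -signr_odd.
have -> : zK K (if odd (index a s) then Z.opp (wedge (rem a s) t)
    else wedge (rem a s) t) =
    (-1) ^+ odd (index a s) * zK K (wedge (rem a s) t).
  by case: odd; rewrite ?zKN ?mulN1r ?mul1r.
congr (_ * _); rewrite IH ?rem_uniq ?size_rem ?ss //.
congr (\det _); apply/matrixP => i j; rewrite !mxE /= remE.
by rewrite -/(del _ s) nth_del ?index_mem.
Qed.

Lemma vec_felem s l t : vec K (felem s l t) = zK K (wedge s t) *: bvec K l.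
Proof.
by rewrite /felem; case: wedge => [|p|p]; rewrite ?vec_nil ?scale0r //
  /vec big_seq1.
Qed.

Lemma real_elem q w s l : (s, l) \in fbasis q w ->
  real q (felem s l) = elem K q s l.
Proof.
case/fbasisP => ss srt _ _ _; apply/ffunP => t; rewrite !ffunE.
rewrite vec_felem (wedgeE (q := q)) ?size_map ?size_tuple //.
  congr (\det _ *: _); apply/matrixP => i j; rewrite !mxE.
  by rewrite (nth_map (tnth t i)) ?size_tuple // -tnth_nth.
exact: (sorted_uniq ltn_trans ltnn).
Qed.

Lemma real_fents e : real 2 (fents e) =
  \sum_(p <- e) zK K p.2 *: real 2 (felem p.1.1 p.1.2).
Proof.
apply/ffunP => t; rewrite ffunE sum_ffunE vec_flatten; apply: eq_bigr => p _.
by rewrite vec_scale !ffunE.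
Qed.

Lemma fents_cochain w e : all (fun p => p.1 \in fbasis 2 w) e ->
  real 2 (fents e) \in cochain K 2 w.
Proof.
move=> /allP eB; rewrite real_fents big_seq; apply: memv_suml => p /eB pB.
apply: memvZ; case: p.1 pB => s l sl; rewrite (real_elem sl).
exact: elem_cochain.
Qed.

Lemma real_flook z : real 2 (flook (ftab z)) = real 2 z.
Proof.
have lookE (i j : 'I_14) : flook (ftab z) [:: val i; val j] = z [:: val i; val j].
  rewrite /flook /ftab -[nth 0%N _ 0]/(val i) -[nth 0%N _ 1]/(val j).
  by rewrite !nth_mkseq //; apply: ltn_ord.
apply/ffunP => t; rewrite !ffunE; congr vec.
by case: t => [[|i [|j [|]]] //= _]; rewrite lookE.
Qed.

(* The coordinates of a multilinear map listed by [B]. *)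
Definition coordB (q : nat) (B : seq (seq nat * nat)) (j : nat)
    (v : multilinear K q) : K :=
  let p := nth ([::], 0%N) B j in
  app v [seq bvec K i | i <- p.1] 0 (inord p.2).

Lemma fcoordsE q w z : fcoords (fgroups q w) z =
  [seq fcoef p.2 (z p.1) | p <- fbasis q w].
Proof.
rewrite /fcoords /fgroups /fbasis; move: (iota 0 14) => R.
elim: (subseqs q R) => [//|s S IH]; rewrite allpairs_cons filter_cat map_cat -IH /=.
set L := [seq l <- R | _].
have -> : [seq fcoef p.2 (z p.1) | p <- [seq (s, l) | l <- R]
    & (sumn [seq fdeg i | i <- p.1])%:Z + w == fdeg p.2] =
    [seq fcoef l (z s) | l <- L] by rewrite filter_map -map_comp.
by case: L.
Qed.

Lemma coordB_real q w z j : (j < size (fbasis q w))%N ->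
  coordB (fbasis q w) j (real q z) = zK K (nth 0 (fcoords (fgroups q w) z) j).
Proof.
move=> jB; rewrite fcoordsE (nth_map ([::], 0%N)) // /coordB.
have := mem_nth ([::], 0%N) jB; case: nth => s l /fbasisP [ss _ s14 l14 _] /=.
by rewrite app_real // vec_coef inordK.
Qed.

Lemma zrank_real q w (rows : seq (seq Z)) (U : {vspace multilinear K q}) :
  (forall r, r \in rows -> exists2 z, real q z \in U
    & r = fcoords (fgroups q w) z) ->
  (zrank (size (fbasis q w)) rows <= \dim U)%N.
Proof.
move=> rep; apply: (zrank_le (phi := coordB (fbasis q w))) => [j a u v|r].
  by rewrite /coordB app_linear !mxE.
by move=> /rep [z zU ->]; exists (real q z) => // j; apply: coordB_real.
Qed.

End Model.

(** * Explicit cocycles and the numerical certificate *)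

Definition ent (i j l : nat) (c : Z) : seq nat * nat * Z := ([:: i; j], l, c).

(** Nineteen integral cochains of weight -2. The checks verify that they are closed and, in total
    weight -2, that together with the 1-coboundaries they span Z^2_{-2}. *)
Definition reps2 : seq entries := [::
  [:: ent 0 12 9 1; ent 1 11 6 (-1)];
  [:: ent 0 8 7 1; ent 0 12 8 (-1); ent 1 11 5 1; ent 1 12 11 (-1)];
  [:: ent 0 8 5 1; ent 0 13 9 1; ent 1 7 4 (-1); ent 1 10 6 (-1)];
  [:: ent 0 8 6 1; ent 0 10 6 1; ent 0 12 9 1; ent 0 13 10 1; ent 1 9 6 1;
      ent 1 13 9 1];
  [:: ent 0 7 4 1; ent 0 9 5 1; ent 0 11 7 1; ent 0 12 11 1; ent 1 6 4 1;
      ent 1 8 5 1; ent 1 9 6 1; ent 1 12 8 1];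
  [:: ent 0 3 2 1; ent 0 6 4 1; ent 0 8 7 1; ent 0 10 7 1; ent 0 13 11 1;
      ent 1 4 2 1; ent 1 6 3 1; ent 1 9 5 1; ent 1 11 5 1; ent 1 13 8 1];
  [:: ent 0 8 5 3; ent 1 11 7 (-1); ent 1 12 9 (-2); ent 2 8 9 (-1);
      ent 2 11 10 (-1); ent 2 12 13 (-2); ent 3 5 9 1; ent 3 8 13 1;
      ent 4 7 10 1; ent 4 11 13 1];
  [:: ent 0 8 5 1; ent 0 13 9 1; ent 1 11 7 1; ent 1 13 10 1; ent 2 9 10 (-1);
      ent 2 10 9 1; ent 3 6 10 1; ent 3 7 9 (-1); ent 3 10 13 1; ent 4 5 10 1;
      ent 4 6 9 (-1); ent 4 9 13 (-1); ent 5 7 13 (-2)];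
  [:: ent 0 8 6 (-3); ent 0 13 10 (-1); ent 1 11 6 5; ent 2 8 10 2;
      ent 2 10 10 (-1); ent 2 11 9 5; ent 2 13 13 1; ent 3 5 10 (-2);
      ent 3 7 10 1; ent 3 9 13 (-1); ent 3 11 13 4; ent 4 6 10 1;
      ent 4 7 9 (-5); ent 4 8 13 1; ent 4 10 13 (-2); ent 5 6 13 1;
      ent 6 7 13 (-3)];
  [:: ent 0 8 6 (-5); ent 0 12 9 3; ent 1 13 9 1; ent 2 8 10 5;
      ent 2 9 9 (-1); ent 2 11 9 2; ent 2 13 13 1; ent 3 5 10 (-5);
      ent 3 6 9 1; ent 3 9 13 (-2); ent 3 11 13 1; ent 4 5 9 1;
      ent 4 7 9 (-2); ent 4 8 13 4; ent 4 10 13 (-1); ent 5 6 13 3;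
      ent 6 7 13 (-1)];
  [:: ent 0 8 5 (-1); ent 0 8 7 3; ent 0 9 6 1; ent 0 10 5 1; ent 0 13 9 1;
      ent 1 8 6 1; ent 1 9 5 1; ent 2 8 9 3; ent 2 8 11 (-3); ent 2 9 8 1;
      ent 2 9 10 (-1); ent 3 5 9 (-3); ent 3 5 11 3; ent 3 6 8 (-1);
      ent 3 6 10 1; ent 3 9 12 1; ent 4 5 8 (-1); ent 4 5 10 1;
      ent 4 8 12 (-3); ent 5 6 12 (-2)];
  [:: ent 0 10 7 (-1); ent 1 7 4 (-1); ent 1 9 7 (-1); ent 1 10 6 (-1);
      ent 1 11 5 (-3); ent 1 11 7 2; ent 1 13 10 (-1); ent 2 10 9 (-1);
      ent 2 10 11 1; ent 2 11 8 (-3); ent 2 11 10 3; ent 3 7 9 1;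
      ent 3 7 11 (-1); ent 3 11 12 (-3); ent 4 6 9 1; ent 4 6 11 (-1);
      ent 4 7 8 3; ent 4 7 10 (-3); ent 4 10 12 1; ent 6 7 12 2];
  [:: ent 0 10 6 (-1); ent 0 12 11 (-1); ent 0 13 8 (-1); ent 1 9 6 (-1);
      ent 1 12 8 (-1); ent 1 13 11 (-1); ent 2 9 9 (-1); ent 2 9 11 1;
      ent 2 10 8 (-1); ent 2 10 10 1; ent 3 6 9 1; ent 3 6 11 (-1);
      ent 3 7 8 1; ent 3 7 10 (-1); ent 3 10 12 (-1); ent 4 5 9 1;
      ent 4 5 11 (-1); ent 4 6 8 1; ent 4 6 10 (-1); ent 4 9 12 1;
      ent 5 7 12 2];
  [:: ent 0 8 7 6; ent 1 4 2 (-1); ent 1 6 3 (-1); ent 1 9 5 (-1);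
      ent 1 11 5 (-3); ent 1 12 11 (-4); ent 1 13 8 (-1); ent 2 8 11 (-2);
      ent 2 11 8 (-2); ent 2 12 13 (-4); ent 2 13 12 (-1); ent 3 5 11 2;
      ent 3 8 13 2; ent 3 9 12 1; ent 3 11 12 (-1); ent 4 7 8 2;
      ent 4 8 12 (-1); ent 4 10 12 1; ent 4 11 13 2; ent 5 6 12 (-1);
      ent 6 7 12 1];
  [:: ent 0 3 2 (-2); ent 0 5 3 (-2); ent 0 8 5 (-2); ent 0 12 10 (-2);
      ent 1 9 7 (-1); ent 1 11 5 1; ent 1 13 10 (-2); ent 2 3 4 2;
      ent 2 5 6 2; ent 2 6 7 1; ent 2 8 9 2; ent 2 9 10 1; ent 2 11 8 1;
      ent 2 12 13 2; ent 3 4 7 (-1); ent 3 11 12 1; ent 4 5 10 1;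
      ent 4 6 11 1; ent 4 7 8 (-1); ent 4 9 13 1; ent 4 11 13 (-1);
      ent 6 7 12 (-1)];
  [:: ent 0 8 7 1; ent 0 10 5 (-1); ent 0 13 9 (-2); ent 1 4 2 (-2);
      ent 1 7 4 (-2); ent 1 11 7 (-2); ent 1 12 9 (-2); ent 2 4 3 (-2);
      ent 2 6 5 (-1); ent 2 7 6 (-2); ent 2 8 11 (-1); ent 2 10 9 (-1);
      ent 2 11 10 (-2); ent 2 12 13 (-2); ent 3 4 5 (-1); ent 3 5 11 1;
      ent 3 6 8 (-1); ent 3 7 9 (-1); ent 3 8 13 1; ent 3 10 13 (-1);
      ent 4 8 12 (-1); ent 5 6 12 (-1)];
  [:: ent 0 2 0 1; ent 0 4 2 (-1); ent 0 9 5 2; ent 0 11 7 1; ent 0 12 11 2;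
      ent 1 8 5 3; ent 1 12 8 3; ent 1 12 10 (-5); ent 2 4 4 1;
      ent 2 5 5 (-1); ent 2 7 7 1; ent 2 8 10 5; ent 2 9 9 (-2);
      ent 2 11 11 1; ent 2 12 12 1; ent 3 5 8 (-2); ent 3 5 10 (-5);
      ent 3 6 9 1; ent 3 8 12 (-2); ent 3 9 13 (-3); ent 4 5 9 1;
      ent 4 8 13 5; ent 5 6 13 4];
  [:: ent 0 11 7 (-3); ent 0 12 11 (-3); ent 1 2 1 1; ent 1 3 2 1;
      ent 1 8 5 (-1); ent 1 10 7 (-2); ent 1 11 6 5; ent 1 12 8 (-2);
      ent 2 3 3 1; ent 2 5 5 1; ent 2 7 7 (-1); ent 2 8 8 1; ent 2 10 10 (-2);
      ent 2 11 9 5; ent 2 12 12 1; ent 3 7 10 1; ent 3 11 13 5; ent 4 6 10 1;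
      ent 4 7 9 (-5); ent 4 7 11 (-2); ent 4 10 13 (-3); ent 4 11 12 (-2);
      ent 6 7 13 (-4)];
  [:: ent 0 2 0 (-1); ent 0 4 2 2; ent 0 6 3 (-2); ent 0 9 5 (-1);
      ent 0 10 6 (-3); ent 0 11 7 (-1); ent 0 12 9 (-8); ent 0 12 11 (-1);
      ent 1 2 1 (-1); ent 1 13 9 1; ent 2 3 3 (-2); ent 2 4 4 (-2);
      ent 2 5 5 (-1); ent 2 6 6 (-1); ent 2 7 7 (-1); ent 2 10 10 3;
      ent 2 11 9 (-9); ent 2 12 12 1; ent 2 13 13 1; ent 3 7 10 (-3);
      ent 3 11 13 (-9); ent 4 6 10 (-3); ent 4 7 9 9; ent 4 10 13 3;
      ent 6 7 13 6]].

(** For these and for [reps0] only closedness is checked: their brackets already exhaust the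
    targets. *)
Definition reps1 : seq entries := [::
  [:: ent 0 10 9 1; ent 1 4 4 2; ent 1 10 10 (-2); ent 2 4 6 2; ent 2 6 9 1;
      ent 2 7 10 2; ent 3 4 9 1; ent 3 6 13 1; ent 4 7 13 2];
  [:: ent 0 5 7 1; ent 0 9 11 1; ent 2 9 12 (-1); ent 3 6 12 1; ent 4 5 12 1]].

Definition reps0 : seq entries := [::
  [:: ent 0 3 5 (-1); ent 0 5 8 (-1); ent 2 3 9 1; ent 2 5 13 1]].

Definition dmat (q : nat) (w : int) : seq (seq Z) :=
  let G := fdgroups q w in
  [seq fcoords G (feval (felem p.1 p.2)) | p <- fbasis q w].

Definition emat (w : int) (es : seq entries) : seq (seq Z) :=
  [seq fcoords (fgroups 2 w) (fents e) | e <- es].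

Definition nrmat (w : int) (es es' : seq entries) : seq (seq Z) :=
  let G := fgroups 3 w in
  [seq fcoords G (fnr (flook T) (flook T'))
  | T <- [seq ftab (fents e) | e <- es], T' <- [seq ftab (fents e) | e <- es']].

Definition closed_entries (w : int) (e : entries) : bool :=
  all (fun p => p.1 \in fbasis 2 w) e &&
  all (fun t => let v := feval (fents e) (fterms 2 t) in
               all (fun l => znull (fcoef l v)) (iota 0 14))
    (subseqs 3 (iota 0 14)).

(* In weight w = a + b the cocycles [es2] and the 1-coboundaries bound the rank of
   the differential on 2-cochains from above, hence determine the dimension of
   the 3-coboundaries; those and the brackets of [es] with [es'] are as many as
   the rank of the differential on 3-cochains permits. *)
Definition rank_check (a b : int) (es es' es2 : seq entries) (m : nat) : bool :=
  let w := a + b in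
  let n2 := size (fbasis 2 w) in
  let n3 := size (fbasis 3 w) in
  let n4 := size (fbasis 4 w) in
  let d2 := dmat 2 w in
  let r2 := zrank n3 d2 in
  [&& all (closed_entries a) es, all (closed_entries b) es',
      all (closed_entries w) es2,
      r2 + zrank n2 (dmat 1 w ++ emat w es2) == n2,
      zrank n3 (d2 ++ nrmat w es es') == r2 + m
    & r2 + m + zrank n4 (dmat 3 w) == n3]%N.

(** * The pairing on classes, and the dimension count *)

Section Cohomology.
Variable K : fieldType.
Hypothesis charK : [pchar K] =i pred0.
Local Notation g := 'rV[K]_14.

Lemma nr_linearl (f1 f2 h : multilinear K 2) a :
  nr (a *: f1 + f2) h = a *: nr f1 h + nr f2 h.
Proof.
apply: multilinear_eq => -[[|x [|y [|z [|]]]] //= _].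
rewrite app_linear !app_nr !app_linear !linE.
by apply/rowP => l; rewrite !mxE; ring.
Qed.

Lemma nrC (f h : multilinear K 2) : nr f h = nr h f.
Proof. exact: addrC. Qed.

Lemma nr_linearr (f : multilinear K 2) : linear (nr f).
Proof. by move=> a h1 h2; rewrite !(nrC f) nr_linearl. Qed.

Lemma nr_square (f h : multilinear K 2) :
  nr (f + h) (f + h) = nr f f + (nr h h + 2%:R *: nr f h).
Proof.
have nrD (u v x : multilinear K 2) : nr (u + v) x = nr u x + nr v x.
  by have := nr_linearl u v x 1; rewrite !scale1r.
rewrite nrD (nrC f) (nrC h) !nrD (nrC h f) scaler_nat mulr2n.
by rewrite -addrA; congr (_ + _); rewrite addrA addrC.
Qed.

Lemma mem_cocycle q w (f : multilinear K q) :
  (f \in cocycle K q w) = (f \in cochain K q w) && (diff K q f == 0).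
Proof. by rewrite memv_cap memv_ker. Qed.

Lemma coboundary_sub2 w : (coboundary K 2 w <= cocycle K 2 w)%VS.
Proof.
apply/subvP => _ /memv_imgP [b bC ->].
by rewrite mem_cocycle diff_cochain1 //= diff_diff1.
Qed.

Lemma coboundary_sub3 w : (coboundary K 3 w <= cocycle K 3 w)%VS.
Proof.
apply/subvP => _ /memv_imgP [f fC ->].
rewrite mem_cocycle diff_cochain2 //= diff_diff2 //.
by case/mem_cochain: fC.
Qed.

Lemma nr_cocycle_mem a b (f h : multilinear K 2) :
  f \in cocycle K 2 a -> h \in cocycle K 2 b -> nr f h \in cocycle K 3 (a + b).
Proof.
rewrite !mem_cocycle => /andP [fC /eqP df] /andP [hC /eqP dh].
rewrite nr_cochain //= nr_cocycle //; first by case/mem_cochain: fC.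
by case/mem_cochain: hC.
Qed.

Lemma nr_coboundary_mem a b (f h : multilinear K 2) :
  f \in cocycle K 2 a -> h \in coboundary K 2 b ->
  nr f h \in coboundary K 3 (a + b).
Proof.
rewrite mem_cocycle => /andP [fC /eqP df] /memv_imgP [p pC ->].
rewrite nr_coboundary //; last by case/mem_cochain: fC.
by rewrite memv_img // nr1_cochain.
Qed.

Lemma cls_coboundary3 w b : b \in coboundary K 3 w -> cls K 3 w b = 0.
Proof.
move=> bB; apply/eqP; rewrite vclass_eq0 ?coboundary_sub3 //.
exact: (subvP (coboundary_sub3 w)).
Qed.

Lemma vsval_cocycle q w (u : cohom K q w) : vsval u \in cocycle K q w.
Proof. by apply: (subvP (diffvSl _ _)); apply: subvsP. Qed.

Lemma nr_pairing_cls a b (f h : multilinear K 2) :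
  f \in cocycle K 2 a -> h \in cocycle K 2 b ->
  nr_pairing (cls K 2 a f) (cls K 2 b h) = cls K 3 (a + b) (nr f h).
Proof.
move=> fZ hZ; rewrite /nr_pairing; set f' := vsval _; set h' := vsval _.
have fB : f - f' \in coboundary K 2 a.
  exact: (vsval_vclass (coboundary_sub2 a)).
have hB : h - h' \in coboundary K 2 b.
  exact: (vsval_vclass (coboundary_sub2 b)).
(* Both correction terms bracket a cocycle with a coboundary, so they vanish in cohomology. *)
have -> : nr f h = nr f' h' + (nr f' (h - h') + nr h (f - f')).
  have -> : h - h' = -1 *: h' + h by rewrite scaleN1r addrC.
  have -> : f - f' = -1 *: f' + f by rewrite scaleN1r addrC.
  rewrite !nr_linearr !scaleN1r (nrC h f') (nrC h f).
  by rewrite addrA !addNKr.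
have rB : nr f' (h - h') + nr h (f - f') \in coboundary K 3 (a + b).
  rewrite memvD //; first by apply: nr_coboundary_mem => //; apply: vsval_cocycle.
  by rewrite (addrC a b); apply: nr_coboundary_mem.
apply/esym/eqP; rewrite -subr_eq0 -linearB addrAC subrr add0r.
by apply/eqP; exact: (cls_coboundary3 rB).
Qed.

Lemma nr_pairing_linearl a b (v : cohom K 2 b) :
  linear (fun u : cohom K 2 a => nr_pairing u v).
Proof.
by move=> c u1 u2; rewrite /nr_pairing linearP nr_linearl linearP.
Qed.

Lemma nr_pairing_linearr a b (u : cohom K 2 a) :
  linear (fun v : cohom K 2 b => nr_pairing u v).
Proof.
by move=> c u1 u2; rewrite /nr_pairing linearP nr_linearr linearP.
Qed.

Lemma nr_pairingC a (u v : cohom K 2 a) : nr_pairing u v = nr_pairing v u.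
Proof. by rewrite /nr_pairing nrC. Qed.

Lemma nr_tensor_img a b (f h : multilinear K 2) :
  f \in cocycle K 2 a -> h \in cocycle K 2 b ->
  cls K 3 (a + b) (nr f h) \in limg (nr_tensor K a b).
Proof.
move=> fZ hZ; rewrite -nr_pairing_cls //.
rewrite -(tensor_liftE _ _ (@nr_pairing_linearl a b) (@nr_pairing_linearr a b)).
exact/memv_img/memvf.
Qed.

Lemma nr_sym2_img a (f h : multilinear K 2) :
  f \in cocycle K 2 a -> h \in cocycle K 2 a ->
  cls K 3 (a + a) (nr f h) \in limg (nr_sym2 K a).
Proof.
move=> fZ hZ; rewrite -nr_pairing_cls //.
rewrite -(sym2_liftE _ _ (@nr_pairing_linearl a a) (@nr_pairing_linearr a a)
  (@nr_pairingC a)).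
exact/memv_img/memvf.
Qed.

(** Polarisation: [f+h, f+h] = [f,f] + [h,h] + 2[f,h], and 2 is invertible. *)
Lemma nr_square_eq0 w :
  (forall f, f \in cocycle K 2 w -> cls K 3 (w + w) (nr f f) = 0) ->
  forall f h, f \in cocycle K 2 w -> h \in cocycle K 2 w ->
    cls K 3 (w + w) (nr f h) = 0.
Proof.
have two0 : (2%:R : K) != 0 by move: charK => /pcharf0P ->.
move=> sq0 f h fZ hZ; have := sq0 _ (memvD fZ hZ); rewrite nr_square.
have clsD u v : cls K 3 (w + w) (u + v) = cls K 3 _ u + cls K 3 _ v.
  exact: linearD.
have clsZ c u : cls K 3 (w + w) (c *: u) = c *: cls K 3 _ u by exact: linearZ.
rewrite (clsD (nr f f)) (clsD (nr h h)) clsZ (sq0 f fZ) (sq0 h hZ) !add0r => /eqP.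
by rewrite scaler_eq0 (negPf two0) => /eqP.
Qed.

Lemma closed_entries_cocycle w e :
  closed_entries w e -> real K 2 (fents e) \in cocycle K 2 w.
Proof.
move=> /andP [eB /allP ed]; have eC := fents_cochain K eB.
rewrite mem_cocycle eC; apply/eqP/alternating_eq0.
  by have /mem_cochain [] := diff_cochain2 charK eC.
move=> t srt; rewrite real_diff ffunE; apply/rowP => l; rewrite vec_coef mxE.
have tS : [seq val i | i <- t] \in subseqs 3 (iota 0 14).
  rewrite mem_subseqs size_map size_tuple eqxx subseq_iota14 srt /=.
  by apply/allP => _ /mapP [i _ ->]; apply: ltn_ord.
have /all_ord14/(_ l) := ed _ tS.
by case: fcoef => // _; rewrite zK0.
Qed.

Lemma mem_elems q w p : p \in fbasis q w -> real K q (felem p.1 p.2) \in cochain K q w.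
Proof. by case: p => s l sl; rewrite (real_elem K sl) elem_cochain. Qed.

Lemma fcoords_fdgroups q w z : fcoords (fdgroups q w) (feval z) =
  fcoords (fgroups q.+1 w) (fun t => feval z (fterms q t)).
Proof. by rewrite /fcoords /fdgroups -map_comp. Qed.

Lemma dmat_le q w (U : {vspace multilinear K q.+1}) :
  (diff K q @: cochain K q w <= U)%VS ->
  forall r, r \in dmat q w -> exists2 z, real K q.+1 z \in U
    & r = fcoords (fgroups q.+1 w) z.
Proof.
move=> /subvP dU r /mapP [p pB ->]; rewrite fcoords_fdgroups.
eexists; last by [].
by rewrite -real_diff; apply/dU/memv_img/mem_elems.
Qed.

Lemma dim_cochain_le q w : (\dim (cochain K q w) <= size (fbasis q w))%N.
Proof.
apply: leq_trans (dimvS (cochain_span K q w)) _.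
by rewrite (leq_trans (dim_span _)) // size_map.
Qed.

(** The squeeze between lower bounds. The counts are variables tied by equations, which keeps the
    arithmetic apart from the large computed terms. *)
Lemma cohom3_rank a b (es es' es2 : seq entries) (n2 n3 h r3 b3 z2 : nat) :
  all (closed_entries a) es -> all (closed_entries b) es' ->
  all (closed_entries (a + b)) es2 ->
  n2 = size (fbasis 2 (a + b)) -> n3 = size (fbasis 3 (a + b)) ->
  h = zrank n3 (dmat 2 (a + b) ++ nrmat (a + b) es es') ->
  r3 = zrank (size (fbasis 4 (a + b))) (dmat 3 (a + b)) ->
  b3 = zrank n3 (dmat 2 (a + b)) ->
  z2 = zrank n2 (dmat 1 (a + b) ++ emat (a + b) es2) ->
  (h + r3 = n3)%N -> (b3 + z2 = n2)%N ->
  \dim {: cohom K 3 (a + b)} = (h - b3)%N /\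
  (cocycle K 3 (a + b) <= coboundary K 3 (a + b) +
    <<[seq nr (real K 2 (fents e)) (real K 2 (fents e')) | e <- es, e' <- es']>>)%VS.
Proof.
set w := a + b; set N := [seq nr _ _ | _ <- _, _ <- _].
move=> /allP esZ /allP es'Z /allP es2Z n2E n3E hE r3E b3E z2E hr3 bz2.
have NZ : (<<N>> <= cocycle K 3 w)%VS.
  apply/span_subvP => _ /allpairsP [[e e'] [/esZ eZ /es'Z e'Z ->]].
  by apply: nr_cocycle_mem; apply: closed_entries_cocycle.
have r3_le : (r3 <= \dim (diff K 3 @: cochain K 3 w))%N.
  by rewrite r3E; apply: zrank_real => //; apply: dmat_le.
have dimZ3 : (\dim (cocycle K 3 w) + r3 <= n3)%N.
  rewrite n3E.
  apply: leq_trans (dim_cochain_le 3 w).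
  by rewrite -(limg_ker_dim (diff K 3) (cochain K 3 w)) leq_add2l.
have b3_le : (b3 <= \dim (coboundary K 3 w))%N.
  by rewrite b3E n3E; apply: zrank_real => //; apply: dmat_le.
have h_le : (h <= \dim (coboundary K 3 w + <<N>>))%N.
  rewrite hE n3E; apply: zrank_real => // r; rewrite mem_cat => /orP [].
    by apply: dmat_le; apply: addvSl.
  move=> /allpairsP [[T T'] [/mapP [e eE ->] /mapP [e' e'E ->] ->]].
  eexists; last by [].
  apply: (subvP (addvSr _ _)); apply: memv_span; apply/allpairsP.
  by exists (e, e'); split=> //=; rewrite -real_nr !real_flook.
have z2_le : (z2 <= \dim (cocycle K 2 w))%N.
  rewrite z2E n2E; apply: zrank_real => // r; rewrite mem_cat => /orP [].
    by apply: dmat_le; apply: coboundary_sub2.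
  by move=> /mapP [e /es2Z eZ ->]; exists (fents e) => //; apply: closed_entries_cocycle.
have dimB3 : (\dim (coboundary K 3 w) + z2 <= n2)%N.
  rewrite n2E.
  apply: leq_trans (dim_cochain_le 2 w).
  by rewrite -(limg_ker_dim (diff K 2) (cochain K 2 w)) addnC leq_add2r.
have BNZ : (coboundary K 3 w + <<N>> <= cocycle K 3 w)%VS.
  by rewrite subv_add coboundary_sub3.
have BNZ_dim := dimvS BNZ.
have -> : cocycle K 3 w = (coboundary K 3 w + <<N>>)%VS.
  (* h <= dim (B + N) <= dim Z <= n3 - r3 = h. *)
  by apply/esym/eqP; rewrite eqEdim BNZ; lia.
split; last exact: subvv.
(* Likewise b3 <= dim B <= n2 - z2 = b3, which fixes the dimension of the quotient. *)
transitivity (\dim (cocycle K 3 w :\: coboundary K 3 w)); first exact: dimvf.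
have := dimv_cap_compl (cocycle K 3 w) (coboundary K 3 w).
have /capv_idPr -> := coboundary_sub3 w.
lia.
Qed.

Lemma rank_check_closed a b (es es' es2 : seq entries) (m : nat) :
  rank_check a b es es' es2 m ->
  all (closed_entries a) es /\ all (closed_entries b) es'.
Proof. by case/and5P. Qed.

Lemma rank_checkP a b (es es' es2 : seq entries) (m : nat) :
  rank_check a b es es' es2 m ->
  \dim {: cohom K 3 (a + b)} = m /\
  (cocycle K 3 (a + b) <= coboundary K 3 (a + b) +
    <<[seq nr (real K 2 (fents e)) (real K 2 (fents e')) | e <- es, e' <- es']>>)%VS.
Proof.
case/and5P => esZ es'Z es2Z /eqP bz2 /andP [/eqP hE /eqP hr3].
rewrite -hE in hr3.
have [dimH ZN] := cohom3_rank esZ es'Z es2Z erefl erefl erefl erefl erefl erefl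
  hr3 bz2.
by split=> //; rewrite dimH hE addKn.
Qed.

End Cohomology.

(** * Surjectivity, ranks and the nonzero obstruction *)

Section Main.
Variable K : fieldType.
Hypothesis charK : [pchar K] =i pred0.

Lemma cohom3_span w (N : seq (multilinear K 3)) (L : {vspace cohom K 3 w}) :
  (cocycle K 3 w <= coboundary K 3 w + <<N>>)%VS ->
  (forall v, v \in N -> cls K 3 w v \in L) -> L = fullv.
Proof.
move=> ZN NL; apply/eqP; rewrite eqEsubv subvf; apply/subvP => u _.
rewrite -(vclass_vsval u); have := subvP ZN _ (vsval_cocycle u).
case/memv_addP => b bB [v vN ->]; rewrite -/(cls K 3 w).
have -> : cls K 3 w (b + v) = cls K 3 w v.
  by apply/eqP; rewrite linearD /= -subr_eq0 addrK; apply/eqP/cls_coboundary3.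
have /subvP : (<<N>> <= cls K 3 w @^-1: L)%VS.
  by apply/span_subvP => x /NL xL; rewrite -memv_preim.
by move/(_ _ vN); rewrite -memv_preim.
Qed.

End Main.

(** Here and in total weight -3 the list of extra 2-cocycles is empty: the 1-coboundaries alone fill
    Z^2. In total weight -2 they are completed by [reps2]. *)
Lemma rank_check22 : rank_check (-2) (-2) reps2 reps2 [::] 39.
Proof. by vm_compute. Qed.

Lemma rank_check21 : rank_check (-2) (-1) reps2 reps1 [::] 12.
Proof. by vm_compute. Qed.

Lemma rank_check20 : rank_check (-2) 0 reps2 reps0 reps2 2.
Proof. by vm_compute. Qed.

Lemma rank_check11 : rank_check (-1) (-1) reps1 reps1 reps2 2.
Proof. by vm_compute. Qed.

Theorem theorem7p9 (K : fieldType) (charK : [pchar K] =i pred0) :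
  [/\ (limg (nr_sym2 K (-2) : 'Hom(_, cohom K 3 (-4))) = fullv
       /\ \dim (limg (nr_sym2 K (-2))) = 39%N),
      (limg (nr_tensor K (-2) (-1) : 'Hom(_, cohom K 3 (-3))) = fullv
       /\ \dim (limg (nr_tensor K (-2) (-1))) = 12%N),
      (limg (nr_tensor K (-2) 0 : 'Hom(_, cohom K 3 (-2))) = fullv
       /\ \dim (limg (nr_tensor K (-2) 0)) = 2%N),
      (limg (nr_sym2 K (-1) : 'Hom(_, cohom K 3 (-2))) = fullv
       /\ \dim (limg (nr_sym2 K (-1))) = 2%N)
    & exists (w : int) (f : multilinear K 2),
        [/\ w < 0, f \in cocycle K 2 w
          & cls K 3 (w + w) (2%:R^-1 *: nr f f) != 0]].
Proof.
have in_Z w es e : all (closed_entries w) es -> e \in es ->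
    real K 2 (fents e) \in cocycle K 2 w.
  by move=> /allP esZ /esZ; apply: closed_entries_cocycle.
have sym w es : all (closed_entries w) es -> forall v,
    v \in [seq nr (real K 2 (fents e)) (real K 2 (fents e')) | e <- es, e' <- es] ->
    cls K 3 (w + w) v \in limg (nr_sym2 K w).
  move=> esZ _ /allpairsP [[e e'] [eE e'E ->]].
  by apply: nr_sym2_img => //; apply: in_Z esZ _.
have tens w w' es es' : all (closed_entries w) es -> all (closed_entries w') es' ->
    forall v, v \in [seq nr (real K 2 (fents e)) (real K 2 (fents e'))
                    | e <- es, e' <- es'] ->
    cls K 3 (w + w') v \in limg (nr_tensor K w w').
  move=> esZ es'Z _ /allpairsP [[e e'] [eE e'E ->]].
  by apply: nr_tensor_img => //; [apply: in_Z esZ _ | apply: in_Z es'Z _].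
have [reps2Z _] := rank_check_closed rank_check22.
have [_ reps0Z] := rank_check_closed rank_check20.
have [reps1Z _] := rank_check_closed rank_check11.
have [dim4 Z4] := rank_checkP charK rank_check22.
have [dim3 Z3] := rank_checkP charK rank_check21.
have [dim20 Z20] := rank_checkP charK rank_check20.
have [dim11 Z11] := rank_checkP charK rank_check11.
have sur4 := cohom3_span charK Z4 (sym _ _ reps2Z).
have sur3 := cohom3_span charK Z3 (tens _ _ _ _ reps2Z reps1Z).
have sur20 := cohom3_span charK Z20 (tens _ _ _ _ reps2Z reps0Z).
have sur11 := cohom3_span charK Z11 (sym _ _ reps1Z).
split.
- by split; [exact: sur4 | rewrite sur4 dim4].
- by split; [exact: sur3 | rewrite sur3 dim3].
- by split; [exact: sur20 | rewrite sur20 dim20].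
- by split; [exact: sur11 | rewrite sur11 dim11].
apply: contrapT => no_square.
have two0 : (2%:R : K) != 0 by move: charK => /pcharf0P ->.
have sq0 f : f \in cocycle K 2 (-2) -> cls K 3 (-2 + -2) (nr f f) = 0.
  move=> fZ; apply/eqP; apply: contra_notT no_square => nff.
  by exists (-2), f; split; rewrite ?linearZ /= ?scaler_eq0 ?invr_eq0 ?(negPf two0).
(* If every square were exact, [cohom3_span] with the zero subspace would give H^3_{-4} = 0, against
   its dimension 39. *)
suff : (fullv : {vspace cohom K 3 (-2 + -2)}) = 0%VS.
  by move=> full0; move: dim4; rewrite full0 dimv0.
apply/esym; apply: (cohom3_span charK Z4) => _ /allpairsP [[e e'] [eE e'E ->]].
rewrite memv0; apply/eqP/(nr_square_eq0 charK sq0).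
  exact: in_Z reps2Z eE.
exact: in_Z reps2Z e'E.
Qed.
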